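(* Let $0<s<1/2$ and let $f(z)=z+\sum_{n=2}^{\infty}a_nz^n$ (with $a_1=1$). (i) If $f\in\mathcal{ST}_{hpl}(s)$, then $|a_n|=O(1/n)$, i.e. there is a constant $C>0$ such that $|a_n|\le C/n$ for all $n=1,2,3,\dots$. (ii) If $f\in\mathcal{CV}_{hpl}(s)$, then $|a_n|=O(1/n^2)$, i.e. there is a constant $C>0$ such that $|a_n|\le C/n^2$ for all $n=1,2,3,\dots$.
   Context: Let $\mathbb{D}=\{z\in\mathbb{C}:|z|<1\}$, and let $\mathcal{S}$ be the class of functions $f(z)=z+\sum_{n\ge2}a_nz^n$ that are holomorphic and univalent in $\mathbb{D}$. For $0<s\le1$ put $\mathfrak{q}_s(z)=(1-z)^{-s}=e^{-s\ln(1-z)}$, $z\in\mathbb{D}$, with the branch of the logarithm such that $\mathfrak{q}_s(0)=1$. For holomorphic functions $p,F$ in $\mathbb{D}$, $p\prec F$ (subordination) means that there is a holomorphic $\omega:\mathbb{D}\to\mathbb{D}$ with $\omega(0)=0$ and $p(z)=F(\omega(z))$ for all $z\in\mathbb{D}$. The class $\mathcal{ST}_{hpl}(s)$ consists of all $f\in\mathcal{S}$ with $\frac{zf'(z)}{f(z)}\prec\mathfrak{q}_s(z)$ in $\mathbb{D}$, and the class $\mathcal{CV}_{hpl}(s)$ consists of all $f\in\mathcal{S}$ with $1+\frac{zf''(z)}{f'(z)}\prec\mathfrak{q}_s(z)$ in $\mathbb{D}$. *)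

(* Defs.v *)
From Stdlib Require Import Reals Lra.
From Coquelicot Require Import Coquelicot.

Open Scope R_scope.

Definition in_disk (z : C) : Prop := Cmod z < 1.

Definition holomorphic_in_disk (f : C -> C) : Prop :=
  forall z : C, in_disk z ->
    ex_derive (K := C_AbsRing) (V := C_NormedModule) f z.

Definition univalent_in_disk (f : C -> C) : Prop :=
  forall z w : C, in_disk z -> in_disk w -> f z = f w -> z = w.

(* f(z) = z + sum_{n >= 2} a_n z^n in the unit disk. *)
Definition normalized_expansion (a : nat -> C) (f : C -> C) : Prop :=
  a 0%nat = RtoC 0 /\ a 1%nat = RtoC 1 /\
  forall z : C, in_disk z ->
    is_pseries (K := C_AbsRing) (V := C_NormedModule) a z (f z).

Definition class_S (f : C -> C) : Prop :=
  holomorphic_in_disk f /\ univalent_in_disk f /\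
  exists a : nat -> C, normalized_expansion a f.

Definition Cexp (z : C) : C :=
  (exp (Re z) * cos (Im z), exp (Re z) * sin (Im z)).

(* Principal logarithm on the right half-plane 0 < Re z; meaningless elsewhere.
   It is only applied to 1 - z with |z| < 1. *)
Definition Cln (z : C) : C := (ln (Cmod z), atan (Im z / Re z)).

Lemma Cexp_Cln (z : C) : 0 < Re z -> Cexp (Cln z) = z.
Proof.
  destruct z as [x y]; unfold Cexp, Cln, Re, Im; cbn [fst snd]; intros Hx.
  assert (Hm : 0 < Cmod (x, y)).
  { apply Cmod_gt_0; intros H; injection H as H1 H2; lra. }
  assert (Hs : sqrt (1 + (y / x)²) = Cmod (x, y) / x).
  { unfold Cmod; cbn [fst snd].
    replace (1 + (y / x)²) with ((x ^ 2 + y ^ 2) / x ^ 2)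
      by (unfold Rsqr; field; lra).
    rewrite sqrt_div_alt by (apply pow_lt; lra).
    rewrite (sqrt_pow2 x) by lra; reflexivity. }
  rewrite exp_ln, cos_atan, sin_atan, Hs by exact Hm.
  f_equal; field; split; lra.
Qed.

Lemma Cln_1 : Cln 1 = 0.
Proof.
  unfold Cln, Re, Im, RtoC; cbn [fst snd].
  change (1, 0) with (RtoC 1).
  rewrite Cmod_1, ln_1; unfold Rdiv; rewrite Rmult_0_l, atan_0; reflexivity.
Qed.

Definition q_hpl (s : R) (z : C) : C :=
  Cexp (- (RtoC s * Cln (1 - z)))%C.

(* p \prec F, for p and F holomorphic in the unit disk. *)
Definition subordinate (p F : C -> C) : Prop :=
  exists w : C -> C,
    holomorphic_in_disk w /\
    (forall z : C, in_disk z -> in_disk (w z)) /\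
    w 0 = RtoC 0 /\
    forall z : C, in_disk z -> p z = F (w z).

(* z f'(z) / f(z); for f in S its singularity at 0 is removable, with value 1. *)
Definition starlike_quotient (f : C -> C) (z : C) : C :=
  if Ceq_dec z 0 then RtoC 1 else (z * C_derive f z / f z)%C.

Definition convex_quotient (f : C -> C) (z : C) : C :=
  (1 + z * C_derive (C_derive f) z / C_derive f z)%C.

Definition ST_hpl (s : R) (f : C -> C) : Prop :=
  class_S f /\ subordinate (starlike_quotient f) (q_hpl s).

Definition CV_hpl (s : R) (f : C -> C) : Prop :=
  class_S f /\ subordinate (convex_quotient f) (q_hpl s).

(* Main.v *)
Require Import Defs.
From Stdlib Require Import Reals Lra.
From Coquelicot Require Import Coquelicot.
Open Scope R_scope.

(** Let g be a normalized power series with z g' = g P pointwise, where P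
    takes its values in the image of the unit disk under (1 - z)^(-s),
    s < 1/2. Then |arg P| <= s PI / 2 < PI / 4, so P lies in the right
    half-plane and Re (P^2) >= c |P|^2 with c = cos (PI s) > 0
    ([q_hpl_sector]). These two properties of P give n |b_n| = O(1) for the
    coefficients b_n of g ([sector_coef_bound]).

    Re P >= 0 makes |g| monotone along rays, so g has no zero but 0
    ([starlike_nonvanishing]), and p = z g' / g is holomorphic in the whole
    disk with p(0) = 1. The mean value property of p^2 and the inequality
    c |p|^2 <= Re (p^2) bound the mean of |p|^2 over every circle by 1 / c
    ([sector_p_mean]). Cauchy's formula then gives
    |p(z)|^2 <= 4 / (c (1 - |z|)) ([sector_p_growth]). Hence the logarithmic
    derivative of |g| along a radius is O((1 - r)^(-1/2)), which is
    integrable, and g is bounded ([sector_bounded]). Finally g' = (g / z) p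
    has bounded mean modulus over circles, and the coefficient (n+1) b_(n+1)
    of g' times r^n is at most this mean ([cpseries_coef_bound]); let r tend
    to 1.

    For part (i), take g = f. For part (ii), take g = z f' (Alexander's
    relation): 1 + z f'' / f' = z g' / g and b_n = n a_n. At a zero of g
    the derivative of |g|^2 along the ray is 0, so the monotonicity argument
    covers the zeros of f' as well and excludes them.

    Cauchy's formula is obtained by differentiating a circle integral with
    respect to a homotopy of the circle ([cauchy_formula]). This requires
    continuous derivatives, which power series have. *)

(** * Complex derivatives *)

Local Notation is_cderive := (is_derive (K := C_AbsRing) (V := C_NormedModule)).
Local Notation ex_cderive := (ex_derive (K := C_AbsRing) (V := C_NormedModule)).
Local Notation is_cpseries := (is_pseries (K := C_AbsRing) (V := C_NormedModule)).

Lemma Cmod_le_plus (z w : C) : Cmod w <= Cmod z + Cmod (w - z).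
Proof.
  replace w with (z + (w - z))%C at 1 by ring. apply Cmod_triangle.
Qed.

(** The norm of the field C and that of C as a normed module over itself are
    both the modulus; this form of differentiability serves for both. *)
Lemma is_cderive_eps (f : C -> C) (z d : C) :
  is_cderive f z d <->
  (forall eps : R, 0 < eps -> exists delta : R, 0 < delta /\
    forall w : C, Cmod (w - z) < delta ->
      Cmod (f w - f z - (w - z) * d) <= eps * Cmod (w - z))%C.
Proof.
  split.
  - intros [_ H] e He.
    destruct (H z (fun P HP => HP) (mkposreal e He)) as [de Hde].
    exists de; split; [apply cond_pos|].
    intros w Hw. exact (Hde w Hw).
  - intros H; split.
    + apply is_linear_scal_l.
    + intros x Hx.
      apply (is_filter_lim_locally_unique (V := AbsRing_NormedModule C_AbsRing)) in Hx.
      subst x.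
      intros e. destruct (H e (cond_pos e)) as [d0 [Hd0 H1]].
      exists (mkposreal d0 Hd0). intros w Hw. exact (H1 w Hw).
Qed.

(** C carries two uniform structures, that of the plane and that of the
    modulus. The rules for products and compositions belong to the second one,
    power series to the first. *)
Lemma is_cderive_AbsRing (f : C -> C) z d :
  is_cderive f z d <->
  is_derive (K:=C_AbsRing) (V:=AbsRing_NormedModule C_AbsRing) f z d.
Proof.
  split; intros [_ H]; (split; [apply is_linear_scal_l | exact H]).
Qed.

Lemma is_cderive_mult (f g : C -> C) z df dg :
  is_cderive f z df -> is_cderive g z dg ->
  is_cderive (fun x => f x * g x)%C z (df * g z + f z * dg)%C.
Proof.
  rewrite !is_cderive_AbsRing; intros Hf Hg.
  exact (is_derive_mult (K:=C_AbsRing) f g z df dg Hf Hg Cmult_comm).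
Qed.

Lemma is_cderive_plus (f g : C -> C) (z df dg : C) :
  is_cderive f z df -> is_cderive g z dg ->
  is_cderive (fun x => f x + g x)%C z (df + dg)%C.
Proof. exact (is_derive_plus f g z df dg). Qed.

Lemma is_cderive_const (c z : C) : is_cderive (fun _ => c) z (RtoC 0).
Proof. exact (is_derive_const (K := C_AbsRing) (V := C_NormedModule) c z). Qed.

Lemma is_cderive_id (z : C) : is_cderive (fun x => x) z (RtoC 1).
Proof.
  apply is_cderive_AbsRing. exact (is_derive_id (K := C_AbsRing) z).
Qed.

Lemma is_cderive_inv (f : C -> C) (z d : C) :
  is_cderive f z d -> f z <> 0 ->
  is_cderive (fun x => / f x)%C z (- (d / (f z * f z)))%C.
Proof.
  intros Hf Hz.
  assert (H : is_cderive Cinv (f z) (- / (f z * f z))%C).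
  { apply is_cderive_eps; intros e He.
    set (y := f z) in *. pose proof (proj1 (Cmod_gt_0 y) Hz) as Hy.
    exists (Rmin (Cmod y / 2) (e * Cmod y ^ 3 / 2)). split.
    { apply Rmin_glb_lt; [lra|]. pose proof (pow_lt _ 3 Hy). nra. }
    intros w Hw.
    assert (H1 := Rlt_le_trans _ _ _ Hw (Rmin_l _ _)).
    assert (H2 := Rlt_le_trans _ _ _ Hw (Rmin_r _ _)).
    assert (H3 : Cmod y / 2 <= Cmod w).
    { pose proof (Cmod_le_plus w y) as T.
      replace (y - w)%C with (- (w - y))%C in T by ring. rewrite Cmod_opp in T. lra. }
    assert (Hw0 : w <> 0) by (apply Cmod_gt_0; lra).
    replace (/ w - / y - (w - y) * - / (y * y))%C
      with ((w - y) * ((w - y) / (w * (y * y))))%C by (field; auto).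
    rewrite Cmod_mult, Rmult_comm. apply Rmult_le_compat_r; [apply Cmod_ge_0|].
    rewrite Cmod_div by (repeat (apply Cmult_neq_0; auto)).
    rewrite !Cmod_mult.
    assert (H4 : 0 < Cmod w * (Cmod y * Cmod y))
      by (repeat apply Rmult_lt_0_compat; lra).
    apply Rmult_le_reg_r with (1 := H4). unfold Rdiv.
    rewrite Rmult_assoc, Rinv_l, Rmult_1_r by lra.
    apply Rlt_le, Rlt_le_trans with (1 := H2).
    replace (e * Cmod y ^ 3 / 2) with (e * (Cmod y / 2 * (Cmod y * Cmod y))) by field.
    apply Rmult_le_compat_l; [lra|]. apply Rmult_le_compat_r; nra. }
  apply is_cderive_AbsRing in Hf.
  replace (- (d / (f z * f z)))%C with (scal (V:=C_NormedModule) d (- / (f z * f z))%C).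
  - exact (is_derive_comp (K:=C_AbsRing) (V:=C_NormedModule) Cinv f z _ _ H Hf).
  - change (d * - / (f z * f z) = - (d / (f z * f z)))%C. field. exact Hz.
Qed.

Lemma in_disk_locally (z : C) : in_disk z -> locally (T := C_UniformSpace) z in_disk.
Proof.
  unfold in_disk; intros Hz.
  apply locally_C. exists (mkposreal (1 - Cmod z) (proj2 (Rlt_0_minus _ _) Hz)).
  intros w Hw. change (Cmod (w - z) < 1 - Cmod z) in Hw.
  pose proof (Cmod_le_plus z w). lra.
Qed.

Lemma is_cderive_ext_disk (f g : C -> C) (z d : C) :
  in_disk z -> (forall w, in_disk w -> f w = g w) ->
  is_cderive f z d -> is_cderive g z d.
Proof.
  intros Hz E. apply is_derive_ext_loc.
  apply locally_C. generalize (in_disk_locally z Hz). apply filter_imp. exact E.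
Qed.

(** Continuity of the derivative is what differentiation under the integral
    sign needs; it is recorded as differentiability because that
    property passes through the rules of differentiation. *)
Definition twice_cderive (G G' : C -> C) : Prop :=
  forall z, in_disk z -> is_cderive G z (G' z) /\ ex_cderive G' z.

Lemma twice_cderive_const (c : C) : twice_cderive (fun _ => c) (fun _ => RtoC 0).
Proof.
  intros z _; split; [apply is_cderive_const | eexists; apply is_cderive_const].
Qed.

Lemma twice_cderive_id : twice_cderive (fun z => z) (fun _ => RtoC 1).
Proof.
  intros z _; split; [apply is_cderive_id | eexists; apply is_cderive_const].
Qed.

Lemma twice_cderive_mult (F G F' G' : C -> C) :
  twice_cderive F F' -> twice_cderive G G' ->
  twice_cderive (fun z => F z * G z)%C (fun z => F' z * G z + F z * G' z)%C.
Proof.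
  intros HF HG z Hz.
  destruct (HF z Hz) as [F1 [F'' F2]], (HG z Hz) as [G1 [G'' G2]]; split.
  - now apply is_cderive_mult.
  - eexists. apply is_cderive_plus; apply is_cderive_mult; eassumption.
Qed.

Lemma twice_cderive_inv (F F' : C -> C) :
  twice_cderive F F' -> (forall z, in_disk z -> F z <> 0) ->
  twice_cderive (fun z => / F z)%C (fun z => - (F' z / (F z * F z)))%C.
Proof.
  intros HF HF0 z Hz. pose proof (HF0 z Hz) as H0.
  destruct (HF z Hz) as [F1 [F'' F2]]; split.
  - now apply is_cderive_inv.
  - eexists. apply (is_cderive_ext_disk
      (fun w => (-(1)) * (F' w * (/ (F w * F w))))%C _ z); [exact Hz | |].
    + intros w Hw. pose proof (HF0 w Hw). field. assumption.
    + apply is_cderive_mult; [apply is_cderive_const|].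
      apply is_cderive_mult; [eassumption|].
      apply is_cderive_inv; [apply is_cderive_mult; eassumption | apply Cmult_neq_0; assumption].
Qed.

Lemma twice_cderive_pow (n : nat) : exists G', twice_cderive (fun z => z ^ n)%C G'.
Proof.
  induction n as [|n [G' IH]].
  - eexists. apply (twice_cderive_const 1).
  - eexists. apply (twice_cderive_mult _ _ _ _ twice_cderive_id IH).
Qed.

(** * Complex power series *)

Local Notation is_cseries := (is_series (K := C_AbsRing) (V := C_NormedModule)).

Lemma pow_n_Cpow (z : C) (n : nat) : pow_n (K := C_AbsRing) z n = (z ^ n)%C.
Proof.
  induction n as [|n IH]; [reflexivity|].
  change (z * pow_n (K := C_AbsRing) z n = z * z ^ n)%C. now rewrite IH.
Qed.

Lemma is_cpseries_cseries (a : nat -> C) (z l : C) :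
  is_cpseries a z l <-> is_cseries (fun n => a n * z ^ n)%C l.
Proof.
  assert (E : forall n, scal (V := C_NormedModule) (pow_n (K := C_AbsRing) z n) (a n)
                        = (a n * z ^ n)%C).
  { intros n. rewrite pow_n_Cpow. apply Cmult_comm. }
  split; apply is_series_ext; intros n; [apply E | symmetry; apply E].
Qed.

Lemma Cmod_cseries_le (u : nat -> C) (b : nat -> R) (l : C) (B : R) :
  (forall n, Cmod (u n) <= b n) -> is_cseries u l -> is_series b B -> Cmod l <= B.
Proof.
  intros Hub Hu Hb.
  apply (is_lim_seq_le (fun n => Cmod (sum_n u n)) (sum_n b) (Cmod l) B).
  - intros n.
    apply Rle_trans with (1 := norm_sum_n_m (V := C_NormedModule) u 0 n).
    apply sum_n_m_le. exact Hub.
  - exact (filterlim_comp _ _ _ _ _ _ _ _ Hu (filterlim_norm (V := C_NormedModule) l)).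
  - exact Hb.
Qed.

(** The terms of a convergent series are bounded, so convergence at a
    positive point bounds from below the radius of the real series of moduli. *)
Lemma CV_radius_Cmod (a : nat -> C) (r : R) (l : C) :
  0 <= r -> is_cpseries a (RtoC r) l ->
  Rbar_le r (CV_radius (fun n => Cmod (a n))).
Proof.
  intros Hr Hl. apply CV_radius_bounded. apply is_cpseries_cseries in Hl.
  destruct (filterlim_bounded _ (ex_intro _ l Hl)) as [M HM].
  exists (M + M). intros n.
  assert (T : forall s t : C, Cmod s <= M -> Cmod (s + t) <= M -> Cmod t <= M + M).
  { intros s t Hs Hst. pose proof (Cmod_triangle (s + t) (- s)) as T.
    rewrite Cmod_opp in T. replace (s + t + - s)%C with t in T by ring. lra. }
  assert (HM' : forall n, Cmod (sum_n (G := C_NormedModule) (fun n => a n * r ^ n)%C n) <= M).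
  { exact HM. }
  replace (Rabs (Cmod (a n) * r ^ n)) with (Cmod (a n * r ^ n)%C).
  - destruct n as [|n].
    + pose proof (HM' O) as H. rewrite sum_O in H.
      pose proof (Cmod_ge_0 (a 0%nat * r ^ 0)). lra.
    + pose proof (HM' n) as H1. pose proof (HM' (S n)) as H2. rewrite sum_Sn in H2.
      exact (T _ _ H1 H2).
  - rewrite Cmod_mult, Cmod_pow, Cmod_R, Rabs_mult, RPow_abs, (Rabs_pos_eq (Cmod _))
      by apply Cmod_ge_0. reflexivity.
Qed.

(** The constant is twice the optimal one; in this form it is the coefficient
    of the twice differentiated series. *)
Lemma Cpow_taylor1_le (z w : C) (rho : R) (n : nat) :
  Cmod z <= rho -> Cmod w <= rho ->
  Cmod (w ^ S (S n) - z ^ S (S n) - INR (S (S n)) * z ^ S n * (w - z))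
    <= INR (S n) * INR (S (S n)) * rho ^ n * Cmod (w - z) ^ 2.
Proof.
  intros Hz Hw. pose proof (Cmod_ge_0 z) as Z0.
  assert (P : forall k, Cmod (z ^ k) <= rho ^ k).
  { intros k. rewrite Cmod_pow. apply pow_incr. lra. }
  induction n as [|n IH].
  - replace (w ^ 2 - z ^ 2 - INR 2 * z ^ 1 * (w - z))%C with ((w - z) * (w - z))%C
      by (simpl; rewrite RtoC_plus; ring).
    rewrite Cmod_mult. simpl. pose proof (Cmod_ge_0 (w - z)). nra.
  - set (N := S (S n)) in *.
    replace (w ^ S N - z ^ S N - INR (S N) * z ^ N * (w - z))%C
      with (w * (w ^ N - z ^ N - INR N * z ^ S n * (w - z))
            + INR N * z ^ S n * ((w - z) * (w - z)))%C.
    + eapply Rle_trans; [apply Cmod_triangle|]. rewrite !Cmod_mult, Cmod_R.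
      rewrite (Rabs_pos_eq (INR N)) by apply pos_INR.
      replace (INR N * INR (S N) * rho ^ S n * Cmod (w - z) ^ 2)
        with (rho * (INR (S n) * INR N * rho ^ n * Cmod (w - z) ^ 2)
              + INR N * rho ^ S n * (Cmod (w - z) * Cmod (w - z))
              + INR N * rho ^ S n * (Cmod (w - z) * Cmod (w - z))).
      2:{ unfold N. rewrite !S_INR. simpl. ring. }
      pose proof (Cmod_ge_0 w) as W0. pose proof (P (S n)) as P1.
      assert (H1 : 0 <= rho ^ S n) by (apply pow_le; lra).
      assert (H2 : 0 <= Cmod (w - z) * Cmod (w - z)) by apply Rle_0_sqr.
      pose proof (pos_INR N) as H3.
      assert (H4 : 0 <= INR N * rho ^ S n * (Cmod (w - z) * Cmod (w - z)))
        by (apply Rmult_le_pos; [apply Rmult_le_pos|]; assumption).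
      assert (H5 : INR N * Cmod (z ^ S n) * (Cmod (w - z) * Cmod (w - z))
                   <= INR N * rho ^ S n * (Cmod (w - z) * Cmod (w - z)))
        by (apply Rmult_le_compat_r; [|apply Rmult_le_compat_l]; assumption).
      assert (H6 := Rmult_le_compat _ _ _ _ W0 (Cmod_ge_0 _) Hw IH). lra.
    + change (z ^ S N)%C with (z * z ^ N)%C. change (w ^ S N)%C with (w * w ^ N)%C.
      change (z ^ N)%C with (z * z ^ S n)%C. rewrite (S_INR N), RtoC_plus. ring.
Qed.

(** Termwise differentiation. The remainder of order one of the series is
    dominated by |w - z|^2 times the twice differentiated real series of
    moduli, taken at a radius strictly inside the disk. *)
Lemma cpseries_derive (a : nat -> C) (f : C -> C) :
  (forall z, in_disk z -> is_cpseries a z (f z)) ->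
  forall z, in_disk z ->
    is_cderive f z (C_derive f z) /\
    is_cpseries (fun n => RtoC (INR (S n)) * a (S n))%C z (C_derive f z).
Proof.
  intros Hf z Hz. unfold in_disk in *.
  pose proof (Cmod_ge_0 z) as Z0.
  (* rho is where the majorant is evaluated, r where the series of f is known
     to converge; strictness leaves room for two differentiations. *)
  set (rho := (1 + Cmod z) / 2). set (r := (1 + rho) / 2).
  assert (Hrho : Cmod z < rho < r) by (unfold r, rho; lra).
  assert (Hr : r < 1) by (unfold r, rho; lra).
  set (A := fun n => Cmod (a n)).
  assert (HA : Rbar_lt (Rabs rho) (CV_radius A)).
  { rewrite Rabs_pos_eq by lra.
    apply Rbar_lt_le_trans with r; [apply Hrho|].
    apply CV_radius_Cmod with (f r); [lra|]. apply Hf.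
    rewrite Cmod_R, Rabs_pos_eq; lra. }
  set (A2 := PS_derive (PS_derive A)).
  assert (HA2 : ex_series (fun n => A2 n * rho ^ n)).
  { apply ex_series_Rabs, CV_disk_inside. unfold A2. now rewrite !CV_radius_derive. }
  assert (Hd : exists d : C, is_cseries (fun n => INR (S n) * a (S n) * z ^ n)%C d).
  { apply (ex_series_le (V := C_CompleteNormedModule) _
      (fun n => PS_derive A n * rho ^ n)).
    - intros n. match goal with |- norm ?x <= _ => change (norm x) with (Cmod x) end.
      rewrite !Cmod_mult, Cmod_R, Cmod_pow.
      rewrite Rabs_pos_eq by apply pos_INR. unfold PS_derive, A.
      apply Rmult_le_compat_l; [|apply pow_incr; lra].
      apply Rmult_le_pos; [apply pos_INR | apply Cmod_ge_0].
    - apply ex_series_Rabs, CV_disk_inside. now rewrite CV_radius_derive. }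
  destruct Hd as [d Hd].
  assert (D : is_cderive f z d).
  { apply is_cderive_eps. intros e He.
    pose proof (Series_correct _ HA2) as HS. set (B := Series _) in HS.
    assert (HB : 0 <= B).
    { apply (Rle_trans _ (Cmod 0)); [apply Cmod_ge_0|].
      apply (Cmod_cseries_le (fun _ => RtoC 0) _ _ _) with (3 := HS).
      - intros n. rewrite Cmod_0. unfold A2, PS_derive, A.
        repeat apply Rmult_le_pos; (apply pos_INR || apply Cmod_ge_0 || apply pow_le; lra).
      - unfold is_series. apply filterlim_ext with (fun _ : nat => zero (G := C_NormedModule)).
        + intros n. induction n as [|n IH]; [now rewrite sum_O|].
          rewrite sum_Sn, <- IH. symmetry; apply (plus_zero_r (G := C_NormedModule)).
        + apply filterlim_const. }
    exists (Rmin (rho - Cmod z) (e / (B + 1))). split.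
    { apply Rmin_glb_lt; [lra|]. apply Rdiv_lt_0_compat; lra. }
    intros w Hw.
    assert (H1 := Rlt_le_trans _ _ _ Hw (Rmin_l _ _)).
    assert (H2 := Rlt_le_trans _ _ _ Hw (Rmin_r _ _)).
    assert (Hwr : Cmod w <= rho) by (pose proof (Cmod_le_plus z w); lra).
    assert (Fw := Hf w ltac:(lra)). assert (Fz := Hf z ltac:(lra)).
    apply is_cpseries_cseries in Fw. apply is_cpseries_cseries in Fz.
    set (E := fun n => (a n * (w ^ n - z ^ n - INR n * z ^ pred n * (w - z)))%C).
    assert (HE : is_cseries E (f w - f z - (w - z) * d)%C).
    { assert (Hd0 : is_cseries (fun n => INR n * a n * z ^ pred n)%C d).
      { apply (is_series_decr_1 (V := C_NormedModule)).
        replace (plus d _) with d; [exact Hd|].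
        change (d = d + - (INR 0 * a 0%nat * 1))%C. simpl. ring. }
      generalize (is_series_minus (V := C_NormedModule) _ _ _ _
        (is_series_minus (V := C_NormedModule) _ _ _ _ Fw Fz)
        (is_series_scal (V := C_NormedModule) (w - z)%C _ _ Hd0)).
      apply is_series_ext. intros n. unfold E.
      change (a n * w ^ n + - (a n * z ^ n) + - ((w - z) * (INR n * a n * z ^ pred n))
        = a n * (w ^ n - z ^ n - INR n * z ^ pred n * (w - z)))%C. ring. }
    assert (HE2 : is_cseries (fun n => E (S (S n))) (f w - f z - (w - z) * d)%C).
    { apply (is_series_incr_n (V := C_NormedModule) E 2); [auto|].
      replace (plus _ _) with (f w - f z - (w - z) * d)%C; [exact HE|].
      simpl pred. rewrite sum_Sn, sum_O.
      change (f w - f z - (w - z) * d = f w - f z - (w - z) * d + (E 0%nat + E 1%nat))%C.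
      unfold E, pred. change (INR 0) with 0. change (INR 1) with 1. simpl Cpow. ring. }
    apply Rle_trans with (Cmod (w - z) ^ 2 * B).
    - refine (Cmod_cseries_le _ (fun n => Cmod (w - z) ^ 2 * (A2 n * rho ^ n)) _ _ _ HE2
        (is_series_scal_l (Cmod (w - z) ^ 2) _ _ HS)).
      intros n. unfold E. rewrite Cmod_mult.
      pose proof (Cpow_taylor1_le z w rho n ltac:(lra) Hwr) as T.
      apply Rle_trans with (1 := Rmult_le_compat_l _ _ _ (Cmod_ge_0 _) T).
      unfold A2, PS_derive, A. right. ring.
    - replace (Cmod (w - z) ^ 2 * B) with (Cmod (w - z) * B * Cmod (w - z)) by ring.
      apply Rmult_le_compat_r; [apply Cmod_ge_0|].
      apply Rle_trans with (e / (B + 1) * (B + 1)); [|right; field; lra].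
      apply Rmult_le_compat; try lra. apply Cmod_ge_0. }
  rewrite (is_C_derive_unique f z d D).
  split; [exact D | now apply is_cpseries_cseries].
Qed.

Lemma twice_cderive_cpseries (a : nat -> C) (f : C -> C) :
  (forall z, in_disk z -> is_cpseries a z (f z)) -> twice_cderive f (C_derive f).
Proof.
  intros Hf z Hz. pose proof (cpseries_derive a f Hf) as D. split.
  - now apply D.
  - eexists.
    now apply (cpseries_derive _ (C_derive f) (fun w Hw => proj2 (D w Hw))).
Qed.

(** The value at 0 is the one that makes this the sum of the shifted series. *)
Definition shift_series (a : nat -> C) (f : C -> C) (z : C) : C :=
  if Ceq_dec z 0 then a 1%nat else ((f z - a 0%nat) / z)%C.

Lemma cpseries_0 (a : nat -> C) (l : C) : is_cpseries a (RtoC 0) l -> l = a 0%nat.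
Proof.
  intros H. apply (filterlim_locally_unique (F := eventually) _ l (a 0%nat) H).
  exact (is_pseries_0 (K := C_AbsRing) (V := C_NormedModule) a).
Qed.

Lemma shift_series_cpseries (a : nat -> C) (f : C -> C) (z : C) :
  is_cpseries a z (f z) ->
  is_cpseries (fun n => a (S n)) z (shift_series a f z).
Proof.
  intros H. unfold shift_series. destruct (Ceq_dec z 0) as [->|Hz].
  - exact (is_pseries_0 (K := C_AbsRing) (V := C_NormedModule) (fun n => a (S n))).
  - replace ((f z - a 0%nat) / z)%C
      with (scal (V := C_NormedModule) (/ z)%C (plus (f z) (opp (a 0%nat)))).
    + apply (is_pseries_decr_1 (K := C_AbsRing) (V := C_NormedModule)); [|exact H].
      change (/ z * z = 1)%C. field. exact Hz.
    + change (/ z * (f z + - a 0%nat) = (f z - a 0%nat) / z)%C. field. exact Hz.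
Qed.

Lemma shift_series_eq (a : nat -> C) (f : C -> C) (z : C) :
  is_cpseries a z (f z) -> f z = (a 0%nat + z * shift_series a f z)%C.
Proof.
  intros H. unfold shift_series. destruct (Ceq_dec z 0) as [->|Hz].
  - rewrite (cpseries_0 a (f 0) H). ring.
  - field. exact Hz.
Qed.

(** * Plane curves *)

(** ring and field recognize an equality in R only if its type is displayed as
    R, not as the carrier of a normed module. *)
Ltac as_real_eq := match goal with |- ?a = ?b => change (a = b :> R) end.

Lemma Im_le_Cmod (z : C) : Rabs (Im z) <= Cmod z.
Proof.
  eapply Rle_trans; [apply Rmax_r | apply (Rmax_Cmod z)].
Qed.

Lemma Re_le_Cmod (z : C) : Re z <= Cmod z.
Proof. eapply Rle_trans; [apply Rle_abs | apply re_le_Cmod]. Qed.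

Lemma sqrt2_le_2 : sqrt 2 <= 2.
Proof.
  rewrite <- (sqrt_square 2) at 2 by lra. apply sqrt_le_1; lra.
Qed.

(** Coordinatewise, so that real calculus applies to each coordinate. *)
Definition is_derive_curve (c : R -> C) (t : R) (d : C) : Prop :=
  is_derive (fun u => Re (c u)) t (Re d) /\ is_derive (fun u => Im (c u)) t (Im d).

(** Half of the Cauchy-Riemann equations; the other half follows after
    multiplication by - Ci. *)
Lemma Re_cderive_differentiable (G : C -> C) (x y : R) (d : C) :
  is_cderive G (x, y) d ->
  differentiable_pt_lim (fun u v => Re (G (u, v))) x y (Re d) (- Im d).
Proof.
  intros H e. apply is_cderive_eps with (eps := e / 2) in H; [|apply is_pos_div_2].
  destruct H as [dl [Hdl H]].
  exists (mkposreal (dl / 2) ltac:(lra)). intros u v Hu Hv. simpl in Hu, Hv.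
  assert (HM : Cmod ((u, v) - (x, y))%C <= 2 * Rmax (Rabs (u - x)) (Rabs (v - y))).
  { eapply Rle_trans; [apply Cmod_2Rmax|]. simpl.
    apply Rmult_le_compat_r; [eapply Rle_trans; [apply Rabs_pos | apply Rmax_l]|].
    apply sqrt2_le_2. }
  assert (HL : Cmod ((u, v) - (x, y))%C < dl).
  { eapply Rle_lt_trans; [exact HM|].
    assert (Rmax (Rabs (u - x)) (Rabs (v - y)) < dl / 2) by (now apply Rmax_lub_lt). lra. }
  apply H in HL.
  eapply Rle_trans; [|apply Rle_trans with (1 := HL)].
  - eapply Rle_trans; [|apply re_le_Cmod]. right. f_equal.
    unfold Re, Im; simpl. ring.
  - replace (e * Rmax (Rabs (u - x)) (Rabs (v - y)))
      with (e / 2 * (2 * Rmax (Rabs (u - x)) (Rabs (v - y)))) by field.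
    apply Rmult_le_compat_l; [|exact HM]. left. apply is_pos_div_2.
Qed.

Lemma is_derive_curve_comp (G : C -> C) (c : R -> C) (t : R) (d c' : C) :
  is_cderive G (c t) d -> is_derive_curve c t c' ->
  is_derive_curve (fun u => G (c u)) t (d * c')%C.
Proof.
  intros HG [Hx Hy].
  assert (RE : forall (F : C -> C) (e : C), is_cderive F (c t) e ->
    is_derive (fun u => Re (F (c u))) t (Re (e * c')%C)).
  { intros F e HF. replace (c t) with (Re (c t), Im (c t)) in HF by (now destruct (c t)).
    apply Re_cderive_differentiable in HF.
    apply is_derive_Reals. apply is_derive_Reals in Hx. apply is_derive_Reals in Hy.
    pose proof (derivable_pt_lim_comp_2d _ _ _ _ _ _ _ _ HF Hx Hy) as H.
    replace (Re (e * c')%C) with (Re e * Re c' + - Im e * Im c') by (unfold Re, Im; simpl; ring).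
    apply is_derive_Reals. apply is_derive_Reals in H.
    refine (is_derive_ext _ _ _ _ _ H). intros u. simpl. now destruct (c u). }
  split; [now apply RE|].
  replace (Im (d * c')%C) with (Re ((- Ci * d) * c')%C) by (unfold Re, Im; simpl; ring).
  apply is_derive_ext with (fun u => Re (- Ci * G (c u))%C).
  { intros u. unfold Re, Im; simpl. ring. }
  apply (RE (fun z => - Ci * G z)%C).
  replace (- Ci * d)%C with (0 * G (c t) + - Ci * d)%C by ring.
  apply (is_cderive_mult (fun _ => - Ci)%C G); [apply is_cderive_const | exact HG].
Qed.

Lemma is_derive_curve_plus (c e : R -> C) (t : R) (c' e' : C) :
  is_derive_curve c t c' -> is_derive_curve e t e' ->
  is_derive_curve (fun u => c u + e u)%C t (c' + e')%C.
Proof.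
  intros [H1 H2] [H3 H4]; split.
  - exact (is_derive_plus _ _ _ _ _ H1 H3).
  - exact (is_derive_plus _ _ _ _ _ H2 H4).
Qed.

Lemma is_derive_curve_mult (c e : R -> C) (t : R) (c' e' : C) :
  is_derive_curve c t c' -> is_derive_curve e t e' ->
  is_derive_curve (fun u => c u * e u)%C t (c' * e t + c t * e')%C.
Proof.
  intros [H1 H2] [H3 H4]; split.
  - evar_last.
    + exact (is_derive_minus _ _ _ _ _
        (is_derive_mult _ _ _ _ _ H1 H3 Rmult_comm) (is_derive_mult _ _ _ _ _ H2 H4 Rmult_comm)).
    + unfold minus, plus, opp, mult, Re, Im; simpl. ring.
  - evar_last.
    + exact (is_derive_plus _ _ _ _ _
        (is_derive_mult _ _ _ _ _ H1 H4 Rmult_comm) (is_derive_mult _ _ _ _ _ H2 H3 Rmult_comm)).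
    + unfold plus, mult, Re, Im; simpl. ring.
Qed.

Lemma is_derive_curve_const (z : C) (t : R) : is_derive_curve (fun _ => z) t 0.
Proof. split; exact (is_derive_const _ t). Qed.

Lemma is_derive_curve_ray (z : C) (t : R) :
  is_derive_curve (fun u => RtoC u * z)%C t z.
Proof.
  split; unfold Re, Im; simpl; (evar_last; [auto_derive; auto | simpl; ring]).
Qed.

Lemma is_derive_curve_continuous (c : R -> C) (t : R) (c' : C) :
  is_derive_curve c t c' ->
  continuous (fun u => Re (c u)) t /\ continuous (fun u => Im (c u)) t.
Proof.
  intros [H1 H2]; split; apply (ex_derive_continuous (V := R_NormedModule));
    eexists; eassumption.
Qed.

Lemma is_derive_curve_Cmod_continuous (c : R -> C) (t : R) (c' : C) :
  is_derive_curve c t c' -> continuous (fun u => Cmod (c u)) t.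
Proof.
  intros H. apply is_derive_curve_continuous in H. destruct H as [H1 H2].
  apply continuous_ext with (fun u => sqrt (Re (c u) * Re (c u) + Im (c u) * Im (c u))).
  - intros u. unfold Cmod, Re, Im. f_equal. ring.
  - apply (continuous_comp (fun u => Re (c u) * Re (c u) + Im (c u) * Im (c u)) sqrt).
    + apply (continuous_plus (V := R_NormedModule));
        apply (continuous_mult (K := R_AbsRing)); assumption.
    + apply continuous_sqrt.
Qed.

Lemma is_derive_Cmod2 (c : R -> C) (t : R) (c' : C) :
  is_derive_curve c t c' ->
  is_derive (fun u => Cmod (c u) ^ 2) t (2 * Re (Cconj (c t) * c')%C).
Proof.
  intros H. apply is_derive_ext with (fun u => Re (c u) * Re (c u) + Im (c u) * Im (c u)).
  - intros u. unfold Cmod, Re, Im. rewrite pow2_sqrt by nra.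
    as_real_eq. ring.
  - destruct H as [H1 H2]. evar_last.
    + exact (is_derive_plus _ _ _ _ _
        (is_derive_mult _ _ _ _ _ H1 H1 Rmult_comm) (is_derive_mult _ _ _ _ _ H2 H2 Rmult_comm)).
    + unfold plus, mult, Re, Im; simpl. ring.
Qed.

(** * Integrals over circles *)

Definition circle (r theta : R) : C := (r * cos theta, r * sin theta).

Lemma is_derive_curve_circle (r theta : R) :
  is_derive_curve (circle r) theta (Ci * circle r theta)%C.
Proof.
  split; unfold Re, Im, circle; simpl; (evar_last; [auto_derive; auto | simpl; ring]).
Qed.

Lemma Cmod_circle (r theta : R) : 0 <= r -> Cmod (circle r theta) = r.
Proof.
  intros Hr. unfold Cmod, circle; simpl.
  replace (r * cos theta * (r * cos theta * 1) + r * sin theta * (r * sin theta * 1))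
    with (r * r * (Rsqr (sin theta) + Rsqr (cos theta))) by (unfold Rsqr; ring).
  rewrite sin2_cos2, Rmult_1_r. now apply sqrt_square.
Qed.

Lemma circle_2PI (r : R) : circle r (2 * PI) = circle r 0.
Proof. unfold circle. now rewrite cos_2PI, sin_2PI, cos_0, sin_0. Qed.

(** Joint continuity in two real parameters, in the form required for
    differentiation under the integral sign. *)
Definition continuity_2d_C (c : R -> R -> C) (x y : R) : Prop :=
  continuity_2d_pt (fun u v => Re (c u v)) x y /\
  continuity_2d_pt (fun u v => Im (c u v)) x y.

Lemma continuity_2d_C_plus (c e : R -> R -> C) (x y : R) :
  continuity_2d_C c x y -> continuity_2d_C e x y ->
  continuity_2d_C (fun u v => c u v + e u v)%C x y.
Proof.
  intros [H1 H2] [H3 H4]; split;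
    [exact (continuity_2d_pt_plus _ _ _ _ H1 H3) | exact (continuity_2d_pt_plus _ _ _ _ H2 H4)].
Qed.

Lemma continuity_2d_C_mult (c e : R -> R -> C) (x y : R) :
  continuity_2d_C c x y -> continuity_2d_C e x y ->
  continuity_2d_C (fun u v => c u v * e u v)%C x y.
Proof.
  intros [H1 H2] [H3 H4]; split.
  - exact (continuity_2d_pt_minus _ _ _ _
      (continuity_2d_pt_mult _ _ _ _ H1 H3) (continuity_2d_pt_mult _ _ _ _ H2 H4)).
  - exact (continuity_2d_pt_plus _ _ _ _
      (continuity_2d_pt_mult _ _ _ _ H1 H4) (continuity_2d_pt_mult _ _ _ _ H2 H3)).
Qed.

Lemma cderive_continuous_eps (F : C -> C) (z : C) :
  ex_cderive F z -> forall e, 0 < e -> exists d, 0 < d /\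
    forall w, Cmod (w - z) < d -> Cmod (F w - F z) < e.
Proof.
  intros [l H] e He. apply is_cderive_eps with (eps := 1) in H; [|lra].
  destruct H as [d [Hd H]]. pose proof (Cmod_ge_0 l) as L0.
  exists (Rmin d (e / (2 + Cmod l))). split.
  { apply Rmin_glb_lt; [lra|]. apply Rdiv_lt_0_compat; lra. }
  intros w Hw.
  assert (H1 := Rlt_le_trans _ _ _ Hw (Rmin_l _ _)).
  assert (H2 := Rlt_le_trans _ _ _ Hw (Rmin_r _ _)).
  apply H in H1.
  pose proof (Cmod_le_plus ((w - z) * l) (F w - F z)) as T. rewrite Cmod_mult in T.
  apply Rmult_lt_compat_r with (r := 2 + Cmod l) in H2; [|lra].
  unfold Rdiv in H2. rewrite Rmult_assoc, Rinv_l, Rmult_1_r in H2 by lra.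
  pose proof (Cmod_ge_0 (w - z)). lra.
Qed.

Lemma continuity_2d_C_comp (F : C -> C) (c : R -> R -> C) (x y : R) :
  ex_cderive F (c x y) -> continuity_2d_C c x y ->
  continuity_2d_C (fun u v => F (c u v)) x y.
Proof.
  intros HF [H1 H2].
  assert (M : forall e : posreal, locally_2d (fun u v => Cmod (F (c u v) - F (c x y)) < e) x y).
  { intros e. destruct (cderive_continuous_eps _ _ HF e (cond_pos e)) as [d [Hd H]].
    assert (Hd2 : 0 < d / 2) by lra.
    generalize (locally_2d_and _ _ _ _ (H1 (mkposreal _ Hd2)) (H2 (mkposreal _ Hd2))).
    apply locally_2d_impl, locally_2d_forall. intros u v [U V]. simpl in U, V.
    apply H. eapply Rle_lt_trans; [apply Cmod_2Rmax|].
    assert (X : Rmax (Rabs (fst (c u v - c x y)%C)) (Rabs (snd (c u v - c x y)%C)) < d / 2)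
      by (apply Rmax_lub_lt; assumption).
    pose proof sqrt2_le_2.
    assert (0 <= Rmax (Rabs (fst (c u v - c x y)%C)) (Rabs (snd (c u v - c x y)%C)))
      by (eapply Rle_trans; [apply Rabs_pos | apply Rmax_l]).
    nra. }
  split; intros e; generalize (M e); apply locally_2d_impl, locally_2d_forall;
    intros u v; apply Rle_lt_trans.
  - apply (re_le_Cmod (F (c u v) - F (c x y))).
  - apply (Im_le_Cmod (F (c u v) - F (c x y))).
Qed.

(** * Cauchy's formula *)

Lemma is_derive_curve_Re (c : R -> C) (t : R) (d e : C) :
  is_derive_curve c t d -> d = e -> is_derive (fun u => Re (c u)) t (Re e).
Proof. intros [H _] <-. exact H. Qed.

Lemma circle_kernel_neq (z0 : C) (r theta : R) :
  Cmod z0 < r -> (circle r theta - z0)%C <> 0.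
Proof.
  intros Hr E. pose proof (Cmod_ge_0 z0).
  assert (circle r theta = z0) as X.
  { replace (circle r theta) with (circle r theta - z0 + z0)%C by ring. rewrite E. ring. }
  pose proof (Cmod_circle r theta ltac:(lra)) as Y. rewrite X in Y. lra.
Qed.

(** Cauchy's integral formula. The circle is shrunk to z0 along
    straight lines; the derivative of the integrand in the parameter u of the
    shrinking is, up to the factor u, a derivative in theta of a periodic
    function, so the integral does not depend on u. *)
Lemma cauchy_formula (G G' : C -> C) (z0 : C) (r : R) :
  twice_cderive G G' -> Cmod z0 < r -> r < 1 ->
  RInt (fun theta => Re ((G (circle r theta) - G z0)
                         * (circle r theta / (circle r theta - z0)))%C) 0 (2 * PI) = 0.
Proof.
  intros HG Hz0 Hr1. pose proof (Cmod_ge_0 z0) as Z0. pose proof PI_RGT_0 as Hpi.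
  set (gam := fun u theta => (RtoC u * (circle r theta - z0) + z0)%C).
  set (k := fun theta => (circle r theta / (circle r theta - z0))%C).
  set (U := fun u theta => Re ((G (gam u theta) + - G z0) * k theta)%C).
  set (DU := fun u theta => Re (G' (gam u theta) * circle r theta)%C).
  (* The homotopy parameter may leave [0, 1] by dl, so that the integral is
     differentiable at the end points too. *)
  set (dl := (1 - r) / 4). assert (Hdl : 0 < dl) by (unfold dl; lra).
  assert (Hk := fun theta => circle_kernel_neq z0 r theta Hz0).
  assert (Hd : forall u theta, - dl < u < 1 + dl -> in_disk (gam u theta)).
  { intros u theta Hu. unfold in_disk, gam.
    replace (u * (circle r theta - z0) + z0)%C
      with (RtoC u * circle r theta + RtoC (1 - u) * z0)%C by (rewrite RtoC_minus; ring).
    eapply Rle_lt_trans; [apply Cmod_triangle|].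
    rewrite !Cmod_mult, !Cmod_R, Cmod_circle by lra.
    assert (Rabs (1 - u) * Cmod z0 <= Rabs (1 - u) * r)
      by (apply Rmult_le_compat_l; [apply Rabs_pos | lra]).
    apply Rle_lt_trans with ((Rabs u + Rabs (1 - u)) * r); [lra|].
    assert (Rabs u + Rabs (1 - u) <= 1 + 2 * dl)
      by (unfold Rabs; destruct (Rcase_abs u), (Rcase_abs (1 - u)); lra).
    apply Rle_lt_trans with ((1 + 2 * dl) * r); [apply Rmult_le_compat_r; lra|].
    assert (0 < (1 - r) * (1 - r / 2)) by (apply Rmult_lt_0_compat; lra).
    unfold dl. lra. }
  assert (HU : forall u theta, - dl < u < 1 + dl ->
    is_derive (fun u => U u theta) u (DU u theta)).
  { intros u theta Hu. unfold U, DU.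
    eapply is_derive_curve_Re.
    - apply is_derive_curve_mult; [|apply is_derive_curve_const].
      apply is_derive_curve_plus; [|apply is_derive_curve_const].
      apply is_derive_curve_comp; [apply (HG _ (Hd u theta Hu))|].
      apply is_derive_curve_plus; [apply is_derive_curve_ray | apply is_derive_curve_const].
    - unfold k. field. apply Hk. }
  assert (Hgam : forall u theta,
    is_derive_curve (gam u) theta (RtoC u * (Ci * circle r theta))%C).
  { intros u theta. unfold gam.
    replace (u * (Ci * circle r theta))%C
      with (0 * (circle r theta + - z0) + u * (Ci * circle r theta + 0) + 0)%C by ring.
    apply is_derive_curve_plus; [|apply is_derive_curve_const].
    apply (is_derive_curve_mult (fun _ => RtoC u) (fun t => circle r t - z0)%C);
      [apply is_derive_curve_const|].
    apply is_derive_curve_plus; [apply is_derive_curve_circle | apply is_derive_curve_const]. }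
  assert (HV : forall u theta, - dl < u < 1 + dl ->
    is_derive (fun theta => Re (- Ci * G (gam u theta))%C) theta (u * DU u theta)).
  { intros u theta Hu. unfold DU.
    replace (u * Re (G' (gam u theta) * circle r theta)%C)
      with (Re (RtoC u * (G' (gam u theta) * circle r theta))%C) by (unfold Re; simpl; ring).
    eapply is_derive_curve_Re.
    - apply (is_derive_curve_mult (fun _ => - Ci)%C (fun t => G (gam u t)));
        [apply is_derive_curve_const|].
      apply is_derive_curve_comp; [apply (HG _ (Hd u theta Hu)) | apply Hgam].
    - transitivity (- (Ci * Ci) * (RtoC u * (G' (gam u theta) * circle r theta)))%C; [ring|].
      replace (Ci * Ci)%C with (- (1))%C; [ring|].
      unfold Ci, Cmult, Copp, RtoC; simpl. f_equal; ring. }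
  assert (HUc : forall u theta, - dl < u < 1 + dl -> continuous (U u) theta).
  { intros u theta Hu. unfold U.
    eapply is_derive_curve_continuous.
    apply is_derive_curve_mult.
    - apply is_derive_curve_plus; [|apply is_derive_curve_const].
      apply is_derive_curve_comp; [apply (HG _ (Hd u theta Hu)) | apply Hgam].
    - unfold k, Cdiv. apply is_derive_curve_mult; [apply is_derive_curve_circle|].
      apply (is_derive_curve_comp Cinv (fun t => circle r t - z0)%C).
      + apply is_cderive_inv; [apply is_cderive_id | apply Hk].
      + apply is_derive_curve_plus; [apply is_derive_curve_circle | apply is_derive_curve_const]. }
  assert (HDUc : forall u theta, - dl < u < 1 + dl -> continuous (DU u) theta).
  { intros u theta Hu. destruct (proj2 (HG _ (Hd u theta Hu))) as [l Hl].
    eapply is_derive_curve_continuous.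
    apply is_derive_curve_mult; [|apply is_derive_curve_circle].
    apply is_derive_curve_comp; [exact Hl | apply Hgam]. }
  assert (HDU2 : forall u theta, - dl < u < 1 + dl -> continuity_2d_pt DU u theta).
  { intros u theta Hu.
    assert (HC : continuity_2d_C (fun _ v => circle r v) u theta).
    { split; unfold circle, Re, Im; simpl;
        (apply continuity_2d_pt_mult; [apply continuity_2d_pt_const|]);
        apply continuity_1d_2d_pt_comp with (g := fun _ v => v);
        try apply continuity_2d_pt_id2; [apply continuity_cos | apply continuity_sin]. }
    refine (proj1 (continuity_2d_C_mult (fun u v => G' (gam u v)) (fun _ v => circle r v)
      u theta _ HC)).
    apply continuity_2d_C_comp; [apply (HG _ (Hd u theta Hu))|].
    unfold gam.
    assert (HZ : forall z, continuity_2d_C (fun _ _ => z) u theta)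
      by (split; apply continuity_2d_pt_const).
    apply continuity_2d_C_plus; [|apply HZ].
    apply continuity_2d_C_mult; [|apply continuity_2d_C_plus; [exact HC | apply HZ]].
    split; simpl; [apply continuity_2d_pt_id1 | apply continuity_2d_pt_const]. }
  assert (Hloc : forall x, - dl < x < 1 + dl ->
    exists e : posreal, forall u, Rabs (u - x) < e -> - dl < u < 1 + dl).
  { intros x Hx. assert (He : 0 < Rmin (x + dl) (1 + dl - x)) by (apply Rmin_glb_lt; lra).
    exists (mkposreal _ He). simpl. intros u Hu.
    pose proof (Rlt_le_trans _ _ _ Hu (Rmin_l _ _)) as H1.
    pose proof (Rlt_le_trans _ _ _ Hu (Rmin_r _ _)) as H2.
    apply Rabs_def2 in H1. apply Rabs_def2 in H2. lra. }
  set (I := fun u => RInt (U u) 0 (2 * PI)).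
  assert (HI : forall x, - dl < x < 1 + dl -> is_derive I x (RInt (DU x) 0 (2 * PI))).
  { intros x Hx. destruct (Hloc x Hx) as [e He]. evar_last.
    - apply (is_derive_RInt_param U 0 (2 * PI) x).
      + exists e. intros u Hu t _. eexists. apply HU, He, Hu.
      + intros t _. apply continuity_2d_pt_ext_loc with DU; [|now apply HDU2].
        exists e. intros u v Hu _. symmetry. apply is_derive_unique, HU, He, Hu.
      + exists e. intros u Hu. apply (ex_RInt_continuous (V := R_CompleteNormedModule)).
        intros t _. apply HUc, He, Hu.
    - apply RInt_ext. intros t _. now apply is_derive_unique, HU. }
  assert (H0 : forall x, 0 < x < 1 -> is_derive I x 0).
  { intros x Hx. assert (Hx' : - dl < x < 1 + dl) by (unfold dl; lra).
    evar_last; [apply HI, Hx'|].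
    assert (E : x * RInt (DU x) 0 (2 * PI) = 0).
    { change (scal x (RInt (DU x) 0 (2 * PI)) = 0).
      rewrite <- RInt_scal by
        (apply (ex_RInt_continuous (V := R_CompleteNormedModule)); intros t _; now apply HDUc).
      apply is_RInt_unique. evar_last.
      - apply (is_RInt_derive (V := R_CompleteNormedModule)
          (fun theta => Re (- Ci * G (gam x theta))%C)).
        + intros t _. apply (HV x t Hx').
        + intros t _. apply (continuous_scal_r (V := R_NormedModule)). now apply HDUc.
      - unfold gam. rewrite circle_2PI. apply (minus_eq_zero (G := R_AbelianGroup)). }
    apply Rmult_integral in E. destruct E; [lra | assumption]. }
  assert (E1 : I 1 = I 0).
  { destruct (MVT_gen I 0 1 (fun _ => 0)) as [c [_ Hc]].
    - intros x Hx. rewrite Rmin_left, Rmax_right in Hx by lra. now apply H0.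
    - intros x Hx. rewrite Rmin_left, Rmax_right in Hx by lra.
      apply continuity_pt_filterlim.
      apply (ex_derive_continuous (V := R_NormedModule)). eexists. apply HI. unfold dl; lra.
    - lra. }
  transitivity (I 1).
  - apply RInt_ext. intros t _. unfold U, gam, k. do 2 f_equal.
    replace (1 * (circle r t - z0) + z0)%C with (circle r t) by ring. reflexivity.
  - rewrite E1. unfold I. rewrite (RInt_ext _ (fun _ => 0)).
    + rewrite RInt_const. apply (scal_zero_r (V := R_NormedModule)).
    + intros t _. unfold U, gam.
      replace (0 * (circle r t - z0) + z0)%C with z0 by ring.
      replace (G z0 + - G z0)%C with (RtoC 0) by ring. rewrite Cmult_0_l. reflexivity.
Qed.

Definition ex_derive_curve (c : R -> C) : Prop :=
  forall t, exists d, is_derive_curve c t d.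

Lemma ex_derive_curve_const (z : C) : ex_derive_curve (fun _ => z).
Proof. intros t; eexists; apply is_derive_curve_const. Qed.

Lemma ex_derive_curve_circle (r : R) : ex_derive_curve (circle r).
Proof. intros t; eexists; apply is_derive_curve_circle. Qed.

Lemma ex_derive_curve_mult (c e : R -> C) :
  ex_derive_curve c -> ex_derive_curve e -> ex_derive_curve (fun t => c t * e t)%C.
Proof.
  intros Hc He t. destruct (Hc t), (He t). eexists. apply is_derive_curve_mult; eassumption.
Qed.

Lemma ex_derive_curve_pow (c : R -> C) (n : nat) :
  ex_derive_curve c -> ex_derive_curve (fun t => c t ^ n)%C.
Proof.
  intros Hc. induction n as [|n IH].
  - apply (ex_derive_curve_const 1).
  - exact (ex_derive_curve_mult _ _ Hc IH).
Qed.

Lemma ex_derive_curve_comp (F : C -> C) (c : R -> C) :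
  (forall t, ex_cderive F (c t)) -> ex_derive_curve c ->
  ex_derive_curve (fun t => F (c t)).
Proof.
  intros HF Hc t. destruct (HF t), (Hc t). eexists.
  apply is_derive_curve_comp; eassumption.
Qed.

Lemma ex_RInt_curve_Re (c : R -> C) (a b : R) :
  ex_derive_curve c -> ex_RInt (fun t => Re (c t)) a b.
Proof.
  intros H. apply (ex_RInt_continuous (V := R_CompleteNormedModule)). intros t _.
  destruct (H t) as [d Hd]. apply (is_derive_curve_continuous _ _ _ Hd).
Qed.

Lemma ex_RInt_curve_Cmod (c : R -> C) (a b : R) :
  ex_derive_curve c -> ex_RInt (fun t => Cmod (c t)) a b.
Proof.
  intros H. apply (ex_RInt_continuous (V := R_CompleteNormedModule)). intros t _.
  destruct (H t) as [d Hd]. apply (is_derive_curve_Cmod_continuous _ _ _ Hd).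
Qed.

Lemma in_disk_circle (r theta : R) : 0 <= r < 1 -> in_disk (circle r theta).
Proof. intros Hr. unfold in_disk. rewrite Cmod_circle; lra. Qed.

Lemma ex_derive_curve_on_circle (G G' : C -> C) (r : R) :
  twice_cderive G G' -> 0 <= r < 1 -> ex_derive_curve (fun theta => G (circle r theta)).
Proof.
  intros HG Hr. apply ex_derive_curve_comp; [|apply ex_derive_curve_circle].
  intros t. eexists. apply HG. now apply in_disk_circle.
Qed.

Lemma mean_value (G G' : C -> C) (r : R) :
  twice_cderive G G' -> 0 < r < 1 ->
  RInt (fun theta => Re (G (circle r theta))) 0 (2 * PI) = 2 * PI * Re (G 0).
Proof.
  intros HG Hr.
  pose proof (cauchy_formula G G' 0 r HG) as H. rewrite Cmod_0 in H.
  specialize (H ltac:(lra) ltac:(lra)).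
  assert (E : RInt (fun theta => Re (G (circle r theta)) - Re (G 0)) 0 (2 * PI) = 0).
  { refine (eq_trans _ H). apply RInt_ext. intros t _.
    pose proof (circle_kernel_neq 0 r t) as N. rewrite Cmod_0 in N. specialize (N ltac:(lra)).
    replace (circle r t / (circle r t - 0))%C with (RtoC 1).
    2:{ replace (circle r t) with (circle r t - 0)%C at 1 by ring. symmetry. now apply Cinv_r. }
    unfold Re; simpl. as_real_eq. ring. }
  rewrite (RInt_minus (V := R_CompleteNormedModule)) in E.
  - rewrite RInt_const in E.
    assert (X : forall a b c : R, minus a (scal (b - 0) c) = 0 -> a = b * c).
    { intros a b c. unfold minus, plus, opp, scal; simpl; unfold mult; simpl. lra. }
    now apply X.
  - apply ex_RInt_curve_Re, (ex_derive_curve_on_circle _ _ _ HG). lra.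
  - apply ex_RInt_const.
Qed.

Lemma exists_rotation (z : C) : exists l : C, Cmod l = 1 /\ (l * z)%C = Cmod z.
Proof.
  destruct (Ceq_dec z 0) as [->|Hz].
  - exists 1. rewrite Cmod_0, Cmod_1. split; [reflexivity | ring].
  - exists (Cmod z / z)%C. assert (Cmod z <> 0) by (apply Rgt_not_eq, Cmod_gt_0, Hz).
    split; [|field; exact Hz].
    rewrite Cmod_div, Cmod_R, Rabs_pos_eq by (assumption || apply Cmod_ge_0). now field.
Qed.

(** The kernel zeta / (zeta - z0) maps the circle into a half-plane away from
    0, which replaces the evaluation of its integral. *)
Lemma Re_cauchy_kernel (zeta z0 : C) :
  Cmod z0 < Cmod zeta -> 1 / 2 <= Re (zeta / (zeta - z0))%C.
Proof.
  intros H.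
  assert (H2 : Cmod z0 ^ 2 < Cmod zeta ^ 2).
  { pose proof (Cmod_ge_0 z0).
    assert (0 < (Cmod zeta - Cmod z0) * (Cmod zeta + Cmod z0))
      by (apply Rmult_lt_0_compat; lra). lra. }
  unfold Cmod in H2. rewrite !pow2_sqrt in H2 by nra.
  destruct zeta as [x y], z0 as [a b]; simpl in H2. unfold Re; simpl.
  set (N := (x + - a) * ((x + - a) * 1) + (y + - b) * ((y + - b) * 1)).
  assert (HN : 0 < N).
  { unfold N. destruct (Req_dec x a) as [->|Hx].
    - destruct (Req_dec y b) as [->|Hy]; [lra|].
      pose proof (Rsqr_pos_lt (y + - b) ltac:(lra)) as P.
      pose proof (Rle_0_sqr (a + - a)) as Q. unfold Rsqr in P, Q. lra.
    - pose proof (Rsqr_pos_lt (x + - a) ltac:(lra)) as P.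
      pose proof (Rle_0_sqr (y + - b)) as Q. unfold Rsqr in P, Q. lra. }
  apply Rmult_le_reg_r with N; [exact HN|].
  match goal with |- _ <= ?e * N =>
    replace (e * N) with (x * (x + - a) + y * (y + - b)) by (field; lra) end.
  unfold N. lra.
Qed.

(** A function is controlled inside the disk by its mean modulus
    on a circle; a rotation makes the value at z0 positive. *)
Lemma cauchy_bound (G G' : C -> C) (z0 : C) (r : R) :
  twice_cderive G G' -> Cmod z0 < r -> r < 1 ->
  PI * Cmod (G z0)
    <= r / (r - Cmod z0) * RInt (fun theta => Cmod (G (circle r theta))) 0 (2 * PI).
Proof.
  intros HG Hz Hr. pose proof (Cmod_ge_0 z0) as Z0. pose proof PI_RGT_0 as Hpi.
  destruct (exists_rotation (G z0)) as [l [Hl1 Hl2]].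
  pose proof (cauchy_formula _ _ z0 r 
    (twice_cderive_mult _ _ _ _ (twice_cderive_const l) HG) Hz Hr) as E.
  cbv beta in E. rewrite Hl2 in E.
  assert (Hi : ex_RInt (fun theta => Cmod (G (circle r theta))) 0 (2 * PI)).
  { apply ex_RInt_curve_Cmod, (ex_derive_curve_on_circle _ _ _ HG). lra. }
  set (q := r / (r - Cmod z0)).
  assert (L : 0 <= RInt (fun theta => q * Cmod (G (circle r theta)) - / 2 * Cmod (G z0))
                     0 (2 * PI)).
  { apply Rle_trans with (1 := Req_le _ _ (eq_sym E)). apply RInt_le.
    - lra.
    - apply (ex_RInt_curve_Re (fun theta =>
        (l * G (circle r theta) - Cmod (G z0)) * (circle r theta / (circle r theta - z0)))%C).
      apply ex_derive_curve_mult.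
      + intros t.
        destruct (ex_derive_curve_on_circle _ _ r
          (twice_cderive_mult _ _ _ _ (twice_cderive_const l) HG)
          ltac:(lra) t) as [d Hd].
        eexists. apply is_derive_curve_plus; [exact Hd | apply is_derive_curve_const].
      + apply ex_derive_curve_mult; [apply ex_derive_curve_circle|].
        apply (ex_derive_curve_comp Cinv (fun t => circle r t - z0)%C).
        * intros t. eexists. apply is_cderive_inv; [apply is_cderive_id|].
          now apply circle_kernel_neq.
        * intros t. eexists.
          apply is_derive_curve_plus; [apply is_derive_curve_circle | apply is_derive_curve_const].
    - apply (ex_RInt_minus (V := R_NormedModule)).
      + now apply (ex_RInt_scal (V := R_NormedModule)).
      + apply ex_RInt_const.
    - intros t _. set (k := (circle r t / (circle r t - z0))%C).
      assert (Hk : / 2 <= Re k).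
      { pose proof (Re_cauchy_kernel (circle r t) z0) as K.
        rewrite Cmod_circle in K by lra. specialize (K Hz). unfold k. lra. }
      assert (Hq : Cmod k <= q).
      { pose proof (circle_kernel_neq z0 r t Hz) as N.
        unfold k, q. rewrite Cmod_div, Cmod_circle by (assumption || lra).
        apply Rmult_le_compat_l; [lra|]. apply Rinv_le_contravar; [lra|].
        pose proof (Cmod_le_plus z0 (circle r t)) as T. rewrite Cmod_circle in T by lra. lra. }
      replace (Re ((l * G (circle r t) - Cmod (G z0)) * k)%C)
        with (Re (l * G (circle r t) * k)%C - Cmod (G z0) * Re k)
        by (unfold Re; simpl; ring).
      pose proof (Re_le_Cmod (l * G (circle r t) * k)%C) as B.
      rewrite !Cmod_mult, Hl1, Rmult_1_l in B.
      pose proof (Cmod_ge_0 (G (circle r t))) as A1. pose proof (Cmod_ge_0 (G z0)) as A2.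
      assert (Cmod (G (circle r t)) * Cmod k <= Cmod (G (circle r t)) * q)
        by now apply Rmult_le_compat_l.
      assert (Cmod (G z0) * / 2 <= Cmod (G z0) * Re k) by now apply Rmult_le_compat_l.
      lra. }
  rewrite (RInt_minus (V := R_CompleteNormedModule)) in L;
    [|now apply (ex_RInt_scal (V := R_NormedModule)) | apply ex_RInt_const].
  rewrite (RInt_scal (V := R_CompleteNormedModule)), RInt_const in L by exact Hi.
  revert L. unfold minus, plus, opp, scal; simpl; unfold mult; simpl. lra.
Qed.

Lemma circle_mult (r theta : R) : circle r theta = (r * circle 1 theta)%C.
Proof. unfold circle, Cmult, RtoC; simpl. f_equal; ring. Qed.

Lemma circle_conj (theta : R) : (circle 1 theta * Cconj (circle 1 theta))%C = 1.
Proof. rewrite <- Cmod2_conj, Cmod_circle by lra. now rewrite pow1. Qed.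

Lemma ex_derive_curve_conj_circle : ex_derive_curve (fun t => Cconj (circle 1 t)).
Proof.
  intros t. exists (- Ci * Cconj (circle 1 t))%C.
  split; unfold Re, Im, circle; simpl; (evar_last; [auto_derive; auto | simpl; ring]).
Qed.

(** Cauchy's formula for the coefficients, by induction on the index:
    one division by z lowers the index by one. *)
Lemma cpseries_coef_RInt (n : nat) : forall (a : nat -> C) (F : C -> C) (r : R) (l : C),
  (forall z, in_disk z -> is_cpseries a z (F z)) -> 0 < r < 1 ->
  RInt (fun theta => Re (l * F (circle r theta) * Cconj (circle 1 theta) ^ n)%C) 0 (2 * PI)
    = 2 * PI * (r ^ n * Re (l * a n)%C).
Proof.
  induction n as [|n IH]; intros a F r l HF Hr.
  - rewrite (RInt_ext _ (fun theta => Re (l * F (circle r theta))%C)).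
    + rewrite (mean_value (fun z => l * F z)%C _ r
        (twice_cderive_mult _ _ _ _ (twice_cderive_const l) (twice_cderive_cpseries a F HF)) Hr).
      rewrite (cpseries_0 a (F 0)); [simpl pow; as_real_eq; ring|].
      apply HF. unfold in_disk. rewrite Cmod_0. lra.
    + intros t _. simpl Cpow. now rewrite Cmult_1_r.
  - assert (Hr0 : RtoC r <> 0) by (intros H; injection H; lra).
    set (F1 := shift_series a F). set (u := fun theta => Cconj (circle 1 theta)).
    (* The constant term is paired with a negative power of zeta. The product
       has the same real part as its conjugate, which is m zeta^(n+1) on the
       circle and has mean 0. *)
    set (m := (Cconj (l * a 0%nat) / r ^ S n)%C).
    destruct (twice_cderive_pow (S n)) as [P' HP].
    assert (HF1 : forall z, in_disk z -> is_cpseries (fun n => a (S n)) z (F1 z))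
      by (intros z Hz; now apply shift_series_cpseries, HF).
    rewrite (RInt_ext _ (fun theta => Re (m * circle r theta ^ S n)%C
      + r * Re (l * F1 (circle r theta) * u theta ^ n)%C)).
    2:{ intros t _.
      assert (E1 : Re (m * circle r t ^ S n)%C = Re (l * a 0%nat * u t ^ S n)%C).
      { transitivity (Re (Cconj (l * a 0%nat * u t ^ S n)%C)); [|reflexivity]. f_equal.
        unfold u, m.
        rewrite (Cmult_conj (l * a 0%nat)%C), Cpow_conj, Cconj_conj, (circle_mult r t), Cpow_mult_l.
        field. now apply Cpow_nz. }
      rewrite E1. rewrite (shift_series_eq a F (circle r t)) by (apply HF, in_disk_circle; lra).
      fold F1. fold (u t).
      transitivity (Re (l * a 0%nat * u t ^ S n + r * (l * F1 (circle r t) * u t ^ n))%C).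
      - f_equal. rewrite (circle_mult r t) at 1. simpl Cpow.
        replace (l * (a 0%nat + r * circle 1 t * F1 (circle r t)) * (u t * u t ^ n))%C
          with (l * a 0%nat * (u t * u t ^ n)
                + r * (l * F1 (circle r t) * u t ^ n) * (circle 1 t * u t))%C by ring.
        rewrite (circle_conj t : (circle 1 t * u t)%C = 1). ring.
      - unfold Re; simpl. as_real_eq. ring. }
    assert (I1 : ex_RInt (fun theta => Re (m * circle r theta ^ S n)%C) 0 (2 * PI)).
    { apply (ex_RInt_curve_Re (fun theta => m * circle r theta ^ S n)%C).
      apply ex_derive_curve_mult; [apply ex_derive_curve_const|].
      apply ex_derive_curve_pow, ex_derive_curve_circle. }
    assert (I2 : ex_RInt (fun theta => Re (l * F1 (circle r theta) * u theta ^ n)%C) 0 (2 * PI)).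
    { apply (ex_RInt_curve_Re (fun theta => l * F1 (circle r theta) * u theta ^ n)%C).
      apply ex_derive_curve_mult.
      - apply ex_derive_curve_mult; [apply ex_derive_curve_const|].
        apply (ex_derive_curve_on_circle _ _ r (twice_cderive_cpseries _ F1 HF1)). lra.
      - apply ex_derive_curve_pow, ex_derive_curve_conj_circle. }
    rewrite (RInt_plus (V := R_CompleteNormedModule)
      (fun theta => Re (m * circle r theta ^ S n)%C)
      (fun theta => r * Re (l * F1 (circle r theta) * u theta ^ n)%C));
      [|exact I1 | now apply (ex_RInt_scal (V := R_NormedModule))].
    rewrite (RInt_scal (V := R_CompleteNormedModule)
      (fun theta => Re (l * F1 (circle r theta) * u theta ^ n)%C)) by exact I2.
    rewrite (mean_value (fun z => m * z ^ S n)%C _ r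
      (twice_cderive_mult _ _ _ _ (twice_cderive_const m) HP) Hr).
    unfold u. rewrite (IH _ F1 r l HF1 Hr).
    replace (m * 0 ^ S n)%C with (RtoC 0) by (simpl; ring).
    unfold plus, scal; simpl; unfold mult; simpl. as_real_eq. ring.
Qed.

(** The integral formula is applied to a rotation that makes a_n positive. *)
Lemma cpseries_coef_bound (a : nat -> C) (F : C -> C) (r : R) (n : nat) :
  (forall z, in_disk z -> is_cpseries a z (F z)) -> 0 < r < 1 ->
  2 * PI * (r ^ n * Cmod (a n))
    <= RInt (fun theta => Cmod (F (circle r theta))) 0 (2 * PI).
Proof.
  intros HF Hr. pose proof PI_RGT_0 as Hpi.
  assert (HC : ex_derive_curve (fun theta => F (circle r theta)))
    by (apply (ex_derive_curve_on_circle _ _ r (twice_cderive_cpseries a F HF)); lra).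
  destruct (exists_rotation (a n)) as [l [Hl1 Hl2]].
  pose proof (cpseries_coef_RInt n a F r l HF Hr) as E. rewrite Hl2 in E.
  change (Re (Cmod (a n))) with (Cmod (a n)) in E. rewrite <- E. apply RInt_le.
  - lra.
  - apply (ex_RInt_curve_Re (fun theta => l * F (circle r theta) * Cconj (circle 1 theta) ^ n)%C).
    apply ex_derive_curve_mult.
    + now apply ex_derive_curve_mult; [apply ex_derive_curve_const|].
    + apply ex_derive_curve_pow, ex_derive_curve_conj_circle.
  - now apply ex_RInt_curve_Cmod.
  - intros t _. eapply Rle_trans; [apply Re_le_Cmod|].
    rewrite !Cmod_mult, Cmod_pow, Cmod_conj, Cmod_circle, Hl1, pow1 by lra. lra.
Qed.

(** * Functions with z g' / g in a sector *)

Lemma le_of_pow_limit (x K : R) (n : nat) :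
  (forall r, 1 / 2 <= r < 1 -> r ^ n * x <= K) -> x <= K.
Proof.
  intros H. apply Rnot_lt_le. intros HK.
  assert (HC : continuity_pt (fun r => r ^ n * x) 1) by reg.
  destruct (HC (x - K) ltac:(lra)) as [d [Hd HC']].
  set (r := Rmax (1 / 2) (1 - d / 2)).
  assert (Hr : 1 / 2 <= r < 1) by (split; [apply Rmax_l | apply Rmax_lub_lt; lra]).
  assert (Hr2 : 1 - d / 2 <= r) by apply Rmax_r.
  specialize (HC' r). simpl in HC'. unfold R_dist in HC'. rewrite pow1 in HC'.
  specialize (H r Hr).
  assert (X : Rabs (r ^ n * x - 1 * x) < x - K).
  { apply HC'. split; [split; [exact I | lra]|]. rewrite Rabs_left by lra. lra. }
  apply Rabs_def2 in X. lra.
Qed.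

Lemma C_derive_cpseries_0 (b : nat -> C) (g : C -> C) :
  (forall z, in_disk z -> is_cpseries b z (g z)) -> C_derive g 0 = b 1%nat.
Proof.
  intros Hg. assert (D0 : in_disk 0) by (unfold in_disk; rewrite Cmod_0; lra).
  destruct (cpseries_derive b g Hg 0 D0) as [_ H].
  apply cpseries_0 in H. rewrite H. simpl. ring.
Qed.

(** Along a ray, |g|^2 has derivative 2 |g|^2 Re P / t
    where g does not vanish, and derivative 0 where it does. So |g| does not
    decrease, and a zero z <> 0 would make g vanish on [0, z]. *)
Lemma starlike_nonvanishing (b : nat -> C) (g : C -> C) :
  (forall z, in_disk z -> is_cpseries b z (g z)) -> b 0%nat = 0 -> b 1%nat = 1 ->
  (forall z, in_disk z -> g z <> 0 ->
     exists P : C, (z * C_derive g z = g z * P)%C /\ 0 <= Re P) ->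
  forall z, in_disk z -> z <> 0 -> g z <> 0.
Proof.
  intros Hg Hb0 Hb1 HP z Hz Hz0 E.
  assert (Hzp : 0 < Cmod z) by now apply Cmod_gt_0.
  assert (D : forall t, 0 <= t <= 1 -> in_disk (t * z)).
  { intros t Ht. unfold in_disk in *. rewrite Cmod_mult, Cmod_R, Rabs_pos_eq by lra. nra. }
  set (phi := fun t => Cmod (g (RtoC t * z)%C) ^ 2).
  set (dphi := fun t => 2 * Re (Cconj (g (RtoC t * z)) * (C_derive g (RtoC t * z) * z))%C).
  assert (Hphi : forall t, 0 <= t <= 1 -> is_derive phi t (dphi t)).
  { intros t Ht. apply (is_derive_Cmod2 (fun t => g (RtoC t * z)%C)).
    apply is_derive_curve_comp; [|apply is_derive_curve_ray].
    now apply (cpseries_derive b g Hg), D. }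
  assert (Hpos : forall t, 0 < t <= 1 -> 0 <= dphi t).
  { intros t Ht. unfold dphi.
    destruct (Ceq_dec (g (t * z)%C) 0) as [H0|H0].
    - rewrite H0. replace (Cconj 0 * _)%C with (RtoC 0); [simpl; lra|].
      unfold Cconj, Cmult, RtoC; simpl. f_equal; ring.
    - destruct (HP (t * z)%C (D t ltac:(lra)) H0) as [P [HP1 HP2]].
      apply Rmult_le_reg_l with t; [lra|]. rewrite Rmult_0_r.
      set (w := g (t * z)%C) in *. set (d := C_derive g (t * z)%C) in *.
      replace (t * (2 * Re (Cconj w * (d * z))%C))
        with (2 * Re (Cconj w * (t * z * d))%C) by (unfold Re; simpl; ring).
      rewrite HP1.
      replace (Re (Cconj w * (w * P))%C) with ((Re w * Re w + Im w * Im w) * Re P)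
        by (unfold Re, Im; simpl; ring).
      pose proof (Rle_0_sqr (Re w)) as S1. pose proof (Rle_0_sqr (Im w)) as S2.
      unfold Rsqr in S1, S2.
      apply Rmult_le_pos; [lra|]. apply Rmult_le_pos; lra. }
  assert (Z : forall t, 0 < t <= 1 -> g (t * z)%C = 0).
  { intros t Ht. apply Cmod_eq_0.
    destruct (MVT_gen phi t 1 dphi) as [c [Hc1 Hc2]].
    - rewrite Rmin_left, Rmax_right by lra. intros x Hx. apply Hphi. lra.
    - rewrite Rmin_left, Rmax_right by lra. intros x Hx. apply continuity_pt_filterlim.
      apply (ex_derive_continuous (V := R_NormedModule)). eexists. apply Hphi. lra.
    - rewrite Rmin_left, Rmax_right in Hc1 by lra.
      assert (0 <= dphi c * (1 - t)) by (apply Rmult_le_pos; [apply Hpos|]; lra).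
      assert (phi 1 = 0).
      { unfold phi. replace (1 * z)%C with z by ring. rewrite E, Cmod_0. ring. }
      assert (phi t <= 0) by lra. unfold phi in *.
      pose proof (Cmod_ge_0 (g (t * z)%C)).
      destruct (Req_dec (Cmod (g (t * z)%C)) 0) as [|N]; [assumption|].
      assert (0 < Cmod (g (t * z)%C) ^ 2) by (apply pow_lt; lra). lra. }
  assert (D0 : in_disk 0) by (unfold in_disk; rewrite Cmod_0; lra).
  (* Vanishing on a segment issuing from 0 contradicts g'(0) = 1. *)
  pose proof (proj1 (cpseries_derive b g Hg 0 D0)) as H.
  rewrite (C_derive_cpseries_0 b g Hg), Hb1 in H.
  apply is_cderive_eps with (eps := 1 / 2) in H; [|lra]. destruct H as [d [Hd H]].
  set (t := Rmin 1 (d / (2 * Cmod z))).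
  assert (Ht : 0 < t) by (apply Rmin_glb_lt; [lra | apply Rdiv_lt_0_compat; lra]).
  assert (Ht1 : t <= 1) by apply Rmin_l.
  assert (Ht2 : t * Cmod z <= d / 2).
  { apply Rle_trans with (d / (2 * Cmod z) * Cmod z); [|right; field; lra].
    apply Rmult_le_compat_r; [lra | apply Rmin_r]. }
  assert (M : Cmod (t * z) = t * Cmod z) by (rewrite Cmod_mult, Cmod_R, Rabs_pos_eq; lra).
  specialize (H (t * z)%C). rewrite Z in H by lra.
  rewrite (cpseries_0 b (g 0) (Hg 0 D0)), Hb0 in H.
  replace (t * z - 0)%C with (t * z)%C in H by ring.
  replace (0 - 0 - t * z * 1)%C with (- (t * z))%C in H by ring.
  rewrite Cmod_opp, M in H. specialize (H ltac:(lra)).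
  assert (0 < t * Cmod z) by now apply Rmult_lt_0_compat. lra.
Qed.

Section Sector.

Variables (b : nat -> C) (g : C -> C) (c : R).
Hypothesis Hg : forall z, in_disk z -> is_cpseries b z (g z).
Hypothesis Hb0 : b 0%nat = 0.
Hypothesis Hb1 : b 1%nat = 1.
Hypothesis Hc : 0 < c.
Hypothesis HP : forall z, in_disk z -> g z <> 0 ->
  exists P : C, (z * C_derive g z = g z * P)%C /\ 0 <= Re P /\
                c * Cmod P ^ 2 <= Re (P * P)%C.

Let h := shift_series b g.

(** z g' / g, with its removable singularity at 0 filled in. *)
Let p (z : C) : C := (C_derive g z * / h z)%C.

Lemma sector_g_factor z : in_disk z -> g z = (z * h z)%C.
Proof. intros Hz. rewrite (shift_series_eq b g z (Hg z Hz)), Hb0. unfold h. ring. Qed.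

Lemma sector_h_neq_0 z : in_disk z -> h z <> 0.
Proof.
  intros Hz. destruct (Ceq_dec z 0) as [->|H0].
  - unfold h, shift_series. destruct (Ceq_dec 0 0) as [_|N]; [|now contradict N].
    rewrite Hb1. exact C1_nz.
  - intros E. apply (starlike_nonvanishing b g Hg Hb0 Hb1) with (2 := Hz) (3 := H0).
    + intros w Hw Hgw. destruct (HP w Hw Hgw) as [P [H1 [H2 _]]]. now exists P.
    + rewrite sector_g_factor, E by assumption. ring.
Qed.

Lemma sector_p_twice_cderive : exists p', twice_cderive p p'.
Proof.
  assert (Hh : forall z, in_disk z -> is_cpseries (fun n => b (S n)) z (h z))
    by (intros z Hz; now apply shift_series_cpseries, Hg).
  eexists. apply twice_cderive_mult.
  - exact (twice_cderive_cpseries _ _ (fun z Hz => proj2 (cpseries_derive b g Hg z Hz))).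
  - exact (twice_cderive_inv _ _ (twice_cderive_cpseries _ h Hh) sector_h_neq_0).
Qed.

Lemma sector_derive_factor z : in_disk z -> C_derive g z = (h z * p z)%C.
Proof. intros Hz. pose proof (sector_h_neq_0 z Hz). unfold p. field. assumption. Qed.

Lemma sector_p_0 : p 0 = 1.
Proof.
  unfold p, h, shift_series. destruct (Ceq_dec 0 0) as [_|N]; [|now contradict N].
  rewrite (C_derive_cpseries_0 b g Hg), Hb1. field.
Qed.

Lemma sector_p_squared z : in_disk z -> z <> 0 -> c * Cmod (p z * p z) <= Re (p z * p z)%C.
Proof.
  intros Hz H0. pose proof (sector_h_neq_0 z Hz) as Hh.
  assert (Hgz : g z <> 0) by (rewrite sector_g_factor by exact Hz; now apply Cmult_neq_0).
  destruct (HP z Hz Hgz) as [P [H1 [_ H2]]].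
  assert (E : p z = P).
  { rewrite sector_derive_factor, (sector_g_factor z Hz) in H1 by exact Hz.
    replace (p z) with (z * (h z * p z) / (z * h z))%C by (field; now split).
    rewrite H1. field. now split. }
  rewrite E, Cmod_mult. simpl in H2. now rewrite Rmult_1_r in H2.
Qed.

(** By the mean value property, the sector condition turns the
    value p(0) = 1 into a bound of the mean of |p|^2. *)
Lemma sector_p_mean r : 0 < r < 1 ->
  RInt (fun theta => Cmod (p (circle r theta) * p (circle r theta))) 0 (2 * PI) <= 2 * PI / c.
Proof.
  intros Hr. pose proof PI_RGT_0 as Hpi. destruct sector_p_twice_cderive as [p' Hp].
  pose proof (twice_cderive_mult _ _ _ _ Hp Hp) as HG.
  pose proof (mean_value _ _ r HG Hr) as M. cbv beta in M. rewrite sector_p_0 in M.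
  replace (2 * PI * Re (1 * 1)%C) with (2 * PI) in M by (unfold Re; simpl; ring).
  apply Rmult_le_reg_l with c; [exact Hc|].
  replace (c * (2 * PI / c)) with (2 * PI) by (field; lra). rewrite <- M at 2.
  assert (HC := ex_derive_curve_on_circle _ _ r HG ltac:(lra)).
  rewrite <- (RInt_scal (V := R_CompleteNormedModule)
    (fun theta => Cmod (p (circle r theta) * p (circle r theta))))
    by now apply (ex_RInt_curve_Cmod (fun t => p (circle r t) * p (circle r t))%C).
  apply RInt_le.
  - lra.
  - apply (ex_RInt_scal (V := R_NormedModule)).
    now apply (ex_RInt_curve_Cmod (fun t => p (circle r t) * p (circle r t))%C).
  - now apply (ex_RInt_curve_Re (fun t => p (circle r t) * p (circle r t))%C).
  - intros t _. apply sector_p_squared; [apply in_disk_circle; lra|].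
    apply Cmod_gt_0. rewrite Cmod_circle; lra.
Qed.

Lemma sector_p_growth z : in_disk z -> Cmod (p z) ^ 2 <= 4 / (c * (1 - Cmod z)).
Proof.
  intros Hz. unfold in_disk in Hz. pose proof (Cmod_ge_0 z) as Z0.
  pose proof PI_RGT_0 as Hpi. destruct sector_p_twice_cderive as [p' Hp].
  set (r := (1 + Cmod z) / 2).
  assert (Hr : Cmod z < r < 1) by (unfold r; lra).
  pose proof (cauchy_bound _ _ z r (twice_cderive_mult _ _ _ _ Hp Hp) ltac:(lra) ltac:(lra)) as B.
  cbv beta in B. pose proof (sector_p_mean r ltac:(lra)) as M.
  assert (Q : 0 <= r / (r - Cmod z) <= 2 / (1 - Cmod z)).
  { split; [apply Rlt_le, Rdiv_lt_0_compat; lra|].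
    replace (r / (r - Cmod z)) with ((1 + Cmod z) / (1 - Cmod z)) by (unfold r; field; lra).
    apply Rmult_le_compat_r; [|lra]. apply Rlt_le, Rinv_0_lt_compat. lra. }
  apply Rmult_le_reg_l with PI; [exact Hpi|].
  replace (Cmod (p z) ^ 2) with (Cmod (p z * p z)) by (rewrite Cmod_mult; ring).
  apply Rle_trans with (1 := B).
  apply Rle_trans with (2 / (1 - Cmod z) * (2 * PI / c)); [|right; field; lra].
  apply Rle_trans with (r / (r - Cmod z) * (2 * PI / c)).
  - now apply Rmult_le_compat_l.
  - apply Rmult_le_compat_r; [|lra]. apply Rlt_le, Rdiv_lt_0_compat; lra.
Qed.

(** Along a radius |g|' <= 2 |p| |g|, and the bound
    (1 - rho)^(-1/2) of |p| is integrable up to rho = 1. *)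
Lemma sector_radial_bound theta rho : 1 / 2 <= rho < 1 ->
  Cmod (g (circle rho theta)) ^ 2
    <= Cmod (g (circle (1 / 2) theta)) ^ 2 * exp (16 / sqrt c * sqrt (1 / 2)).
Proof.
  intros Hrho. set (L := 8 / sqrt c). assert (Hsc := sqrt_lt_R0 c Hc).
  assert (HL : 0 < L) by (unfold L; apply Rdiv_lt_0_compat; lra).
  replace (16 / sqrt c) with (2 * L) by (unfold L; field; lra).
  set (phi := fun t => Cmod (g (circle t theta)) ^ 2).
  set (dphi := fun t =>
    2 * Re (Cconj (g (circle t theta)) * (C_derive g (circle t theta) * circle 1 theta))%C).
  assert (Hphi : forall t, 0 < t < 1 -> is_derive phi t (dphi t)).
  { intros t Ht. apply (is_derive_Cmod2 (fun t => g (circle t theta))).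
    apply is_derive_curve_comp.
    - apply (cpseries_derive b g Hg), in_disk_circle. lra.
    - unfold circle, is_derive_curve, Re, Im; simpl.
      split; (evar_last; [auto_derive; auto | simpl; ring]). }
  assert (Hd : forall t, 1 / 2 <= t < 1 -> dphi t <= L / sqrt (1 - t) * phi t).
  { intros t Ht. set (z := circle t theta).
    assert (Hz : in_disk z) by (apply in_disk_circle; lra).
    assert (Mz : Cmod z = t) by (apply Cmod_circle; lra).
    assert (Hs : 0 < sqrt (1 - t)) by (apply sqrt_lt_R0; lra).
    assert (Hp : Cmod (p z) <= 2 / (sqrt c * sqrt (1 - t))).
    { pose proof (sector_p_growth z Hz) as G. rewrite Mz in G.
      apply Rsqr_incr_0_var.
      - unfold Rsqr. rewrite <- (sqrt_sqrt c), <- (sqrt_sqrt (1 - t)) in G by lra.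
        simpl in G. rewrite Rmult_1_r in G. apply Rle_trans with (1 := G).
        right. field. split; lra.
      - apply Rlt_le, Rdiv_lt_0_compat; [lra | now apply Rmult_lt_0_compat]. }
    assert (Hh : Cmod (h z) <= 2 * Cmod (g z)).
    { rewrite (sector_g_factor z Hz), Cmod_mult, Mz. pose proof (Cmod_ge_0 (h z)). nra. }
    unfold dphi, phi. fold z.
    pose proof (Re_le_Cmod (Cconj (g z) * (C_derive g z * circle 1 theta))%C) as B.
    rewrite !Cmod_mult, Cmod_conj, (Cmod_circle 1), (sector_derive_factor z Hz), Cmod_mult in B
      by lra.
    pose proof (Cmod_ge_0 (g z)) as A1. pose proof (Cmod_ge_0 (h z)) as A2.
    pose proof (Cmod_ge_0 (p z)) as A3.
    assert (B2 : Cmod (h z) * Cmod (p z) <= 2 * Cmod (g z) * (2 / (sqrt c * sqrt (1 - t))))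
      by now apply Rmult_le_compat.
    assert (B3 := Rmult_le_compat_l _ _ _ A1 B2).
    rewrite <- (sector_derive_factor z Hz) in B.
    replace (L / sqrt (1 - t) * Cmod (g z) ^ 2)
      with (2 * (Cmod (g z) * (2 * Cmod (g z) * (2 / (sqrt c * sqrt (1 - t))))))
      by (unfold L; field; lra).
    rewrite (sector_derive_factor z Hz) in B |- *. lra. }
  (* - 2 L sqrt (1 - t) is a primitive of L / sqrt (1 - t): an integrating
     factor for the inequality dphi <= L / sqrt (1 - t) * phi. *)
  set (Phi := fun t => phi t * exp (2 * L * sqrt (1 - t))).
  set (dPhi := fun t =>
    (dphi t - L / sqrt (1 - t) * phi t) * exp (2 * L * sqrt (1 - t))).
  assert (HPhi : forall t, 0 < t < 1 -> is_derive Phi t (dPhi t)).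
  { intros t Ht. assert (Hs : 0 < sqrt (1 - t)) by (apply sqrt_lt_R0; lra).
    assert (X : is_derive (fun t => exp (2 * L * sqrt (1 - t))) t
      (- (L / sqrt (1 - t)) * exp (2 * L * sqrt (1 - t)))).
    { auto_derive; [lra|]. change (1 + - t) with (1 - t). field. lra. }
    evar_last; [exact (is_derive_mult _ _ _ _ _ (Hphi t Ht) X Rmult_comm)|].
    unfold dPhi, plus, mult; simpl. as_real_eq. ring. }
  assert (Mono : Phi rho <= Phi (1 / 2)).
  { destruct (MVT_gen Phi (1 / 2) rho dPhi) as [x [Hx1 Hx2]].
    - rewrite Rmin_left, Rmax_right by lra. intros x Hx. apply HPhi. lra.
    - rewrite Rmin_left, Rmax_right by lra. intros x Hx. apply continuity_pt_filterlim.
      apply (ex_derive_continuous (V := R_NormedModule)). eexists. apply HPhi. lra.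
    - rewrite Rmin_left, Rmax_right in Hx1 by lra.
      pose proof (Hd x ltac:(lra)) as D.
      assert (0 <= - dPhi x).
      { unfold dPhi. pose proof (exp_pos (2 * L * sqrt (1 - x))). nra. }
      assert (0 <= - dPhi x * (rho - 1 / 2)) by (apply Rmult_le_pos; lra). lra. }
  unfold Phi in Mono. replace (1 - 1 / 2) with (1 / 2) in Mono by lra.
  apply Rle_trans with (2 := Mono).
  rewrite <- (Rmult_1_r (Cmod _ ^ 2)). apply Rmult_le_compat_l; [apply pow2_ge_0|].
  apply Rle_trans with (2 := exp_ineq1_le _).
  assert (0 <= 2 * L * sqrt (1 - rho)) by (apply Rmult_le_pos; [lra | apply sqrt_pos]). lra.
Qed.

(** The bound on the circle of radius 1/2 exists by compactness of [0, 2 PI]. *)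
Lemma sector_bounded : exists M, 0 < M /\ forall rho theta,
  1 / 2 <= rho < 1 -> 0 <= theta <= 2 * PI -> Cmod (g (circle rho theta)) <= M.
Proof.
  assert (HC : ex_derive_curve (fun t => g (circle (1 / 2) t)))
    by (apply (ex_derive_curve_on_circle _ _ _ (twice_cderive_cpseries b g Hg)); lra).
  destruct (bounded_continuity (V := R_NormedModule)
    (fun t => Cmod (g (circle (1 / 2) t))) 0 (2 * PI)) as [M0 HM0].
  { intros t _. destruct (HC t) as [d Hd]. exact (is_derive_curve_Cmod_continuous _ _ _ Hd). }
  set (E := exp (16 / sqrt c * sqrt (1 / 2))). assert (HE : 0 < E) by apply exp_pos.
  exists (1 + M0 ^ 2 * E). split.
  { pose proof (pow2_ge_0 M0). assert (0 <= M0 ^ 2 * E) by (apply Rmult_le_pos; lra). lra. }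
  intros rho theta Hrho Ht. pose proof (sector_radial_bound theta rho Hrho) as B. fold E in B.
  specialize (HM0 theta Ht). change (Rabs (Cmod (g (circle (1 / 2) theta))) < M0) in HM0.
  rewrite Rabs_pos_eq in HM0 by apply Cmod_ge_0.
  set (x := Cmod (g (circle rho theta))) in *.
  assert (x <= 1 + x ^ 2) by nra.
  assert (Cmod (g (circle (1 / 2) theta)) ^ 2 * E <= M0 ^ 2 * E).
  { apply Rmult_le_compat_r; [lra|]. apply pow_incr. split; [apply Cmod_ge_0 | lra]. }
  lra.
Qed.

(** |g'| = |g / z| |p| <= 2 M |p| <= M (1 + |p|^2) on circles of radius at
    least 1/2, and the mean of the right-hand side is at most M (1 + 1 / c). *)
Lemma sector_coef_bound : exists K, 0 < K /\ forall n, INR n * Cmod (b n) <= K.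
Proof.
  destruct sector_bounded as [M [HM0 HM]]. pose proof PI_RGT_0 as Hpi.
  assert (HK : 0 < M * (1 + / c))
    by (apply Rmult_lt_0_compat; [|pose proof (Rinv_0_lt_compat c Hc)]; lra).
  exists (M * (1 + / c)). split; [exact HK|].
  intros [|n]; [rewrite Rmult_0_l; lra|].
  apply (le_of_pow_limit _ _ n). intros r Hr.
  pose proof (cpseries_coef_bound _ (C_derive g) r n
    (fun z Hz => proj2 (cpseries_derive b g Hg z Hz)) ltac:(lra)) as B.
  cbv beta in B. rewrite Cmod_mult, Cmod_R, (Rabs_pos_eq (INR (S n))) in B by apply pos_INR.
  apply Rmult_le_reg_l with (2 * PI); [lra|]. apply Rle_trans with (1 := B).
  destruct sector_p_twice_cderive as [p' Hp]. pose proof (twice_cderive_mult _ _ _ _ Hp Hp) as HG.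
  assert (HC := ex_derive_curve_on_circle _ _ r HG ltac:(lra)).
  assert (Ip : ex_RInt (fun t => Cmod (p (circle r t) * p (circle r t))) 0 (2 * PI))
    by now apply (ex_RInt_curve_Cmod (fun t => p (circle r t) * p (circle r t))%C).
  assert (I2 : ex_RInt (fun t => 1 + Cmod (p (circle r t) * p (circle r t))) 0 (2 * PI)).
  { apply (ex_RInt_plus (V := R_NormedModule)); [apply ex_RInt_const | exact Ip]. }
  apply Rle_trans with
    (RInt (fun t => M * (1 + Cmod (p (circle r t) * p (circle r t)))) 0 (2 * PI)).
  - apply RInt_le.
    + lra.
    + apply (ex_RInt_curve_Cmod (fun t => C_derive g (circle r t))).
      apply (ex_derive_curve_on_circle _ _ r
        (twice_cderive_cpseries _ _ (fun z Hz => proj2 (cpseries_derive b g Hg z Hz)))). lra.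
    + now apply (ex_RInt_scal (V := R_NormedModule)).
    + intros t Ht. set (z := circle r t).
      assert (Hz : in_disk z) by (apply in_disk_circle; lra).
      assert (Hh : Cmod (h z) <= 2 * M).
      { pose proof (HM r t ltac:(lra) ltac:(lra)) as X. fold z in X.
        rewrite (sector_g_factor z Hz), Cmod_mult in X.
        replace (Cmod z) with r in X by (symmetry; apply Cmod_circle; lra).
        pose proof (Cmod_ge_0 (h z)). nra. }
      rewrite (sector_derive_factor z Hz), !Cmod_mult. set (x := Cmod (p z)).
      assert (Hx : 0 <= x) by apply Cmod_ge_0.
      apply Rle_trans with (2 * M * x); [now apply Rmult_le_compat_r|].
      pose proof (Rle_0_sqr (x - 1)) as S. unfold Rsqr in S.
      assert (0 <= M * ((x - 1) * (x - 1))) by (apply Rmult_le_pos; lra). lra.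
  - rewrite (RInt_scal (V := R_CompleteNormedModule)
      (fun t => 1 + Cmod (p (circle r t) * p (circle r t)))) by exact I2.
    rewrite (RInt_plus (V := R_CompleteNormedModule) (fun _ => 1)
      (fun t => Cmod (p (circle r t) * p (circle r t)))) by (apply ex_RInt_const || exact Ip).
    rewrite RInt_const. pose proof (sector_p_mean r ltac:(lra)) as X.
    unfold plus, scal; simpl; unfold mult; simpl.
    apply Rle_trans with (M * ((2 * PI - 0) * 1 + 2 * PI / c)); [|right; field; lra].
    apply Rmult_le_compat_l; lra.
Qed.

End Sector.

(** * The power (1 - z)^(-s) and the coefficient estimates *)

(** The argument of the power is - s times an arctangent, hence of absolute
    value at most s PI / 2 < PI / 4; squaring doubles it. *)
Lemma q_hpl_sector (s : R) (w : C) : 0 < s < 1 / 2 ->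
  0 <= Re (q_hpl s w) /\
  cos (PI * s) * Cmod (q_hpl s w) ^ 2 <= Re (q_hpl s w * q_hpl s w)%C.
Proof.
  intros Hs. pose proof PI_RGT_0 as Hpi. unfold q_hpl, Cexp, Cln.
  set (m := ln _). set (alpha := atan _).
  assert (Ha : - (PI / 2) < alpha < PI / 2)
    by (pose proof (atan_bound (Im (1 - w) / Re (1 - w))); unfold alpha; lra).
  set (e := exp _). assert (He : 0 < e) by apply exp_pos.
  replace (Im (- (s * (m, alpha)))%C) with (- (s * alpha)) by (unfold Im; simpl; ring).
  rewrite cos_neg, sin_neg.
  assert (Hsa : - (PI * s / 2) <= s * alpha <= PI * s / 2) by (split; nra).
  split.
  - unfold Re; simpl. apply Rmult_le_pos; [lra|]. apply cos_ge_0; nra.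
  - replace (Cmod (e * cos (s * alpha), e * - sin (s * alpha)) ^ 2) with (e * e).
    2:{ unfold Cmod. rewrite pow2_sqrt by (apply Rplus_le_le_0_compat; apply pow2_ge_0). simpl.
        pose proof (sin2_cos2 (s * alpha)) as X. unfold Rsqr in X.
        transitivity (e * e * (sin (s * alpha) * sin (s * alpha)
          + cos (s * alpha) * cos (s * alpha))); [rewrite X|]; ring. }
    replace (Re _) with (cos (2 * (s * alpha)) * (e * e))
      by (rewrite cos_2a; unfold Re; simpl; ring).
    apply Rmult_le_compat_r; [apply Rlt_le, Rmult_lt_0_compat; lra|].
    assert (HPs : PI * s <= PI) by nra.
    destruct (Rle_lt_dec 0 (s * alpha)).
    + apply cos_decr_1; lra.
    + rewrite <- (cos_neg (2 * (s * alpha))). apply cos_decr_1; lra.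
Qed.

Theorem theorem3p1 (s : R) (f : C -> C) (a : nat -> C)
  (hs0 : 0 < s) (hs1 : s < 1 / 2) (hfa : normalized_expansion a f) :
  (ST_hpl s f ->
     exists K : R, 0 < K /\
       forall n : nat, (1 <= n)%nat -> Cmod (a n) <= K / INR n) /\
  (CV_hpl s f ->
     exists K : R, 0 < K /\
       forall n : nat, (1 <= n)%nat -> Cmod (a n) <= K / INR n ^ 2).
Proof.
  destruct hfa as [ha0 [ha1 ha]]. pose proof PI_RGT_0 as Hpi.
  assert (Hc : 0 < cos (PI * s)) by (apply cos_gt_0; nra).
  split.
  - intros [_ [w [_ [_ [_ Hw]]]]].
    destruct (sector_coef_bound a f (cos (PI * s)) ha ha0 ha1 Hc) as [K [HK0 HK]].
    { intros z Hz Hfz. exists (q_hpl s (w z)).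
      split; [|apply q_hpl_sector; lra].
      rewrite <- (Hw z Hz). unfold starlike_quotient.
      destruct (Ceq_dec z 0) as [->|_].
      - contradict Hfz. rewrite (cpseries_0 a (f 0) (ha 0 Hz)). exact ha0.
      - field. exact Hfz. }
    exists K. split; [exact HK0|]. intros n Hn.
    assert (Hn' : 0 < INR n) by now apply lt_0_INR.
    apply Rmult_le_reg_l with (INR n); [exact Hn'|].
    replace (INR n * (K / INR n)) with K by (field; lra). apply HK.
  - intros [_ [w [_ [_ [_ Hw]]]]].
    pose proof (cpseries_derive a f ha) as D.
    set (b := PS_incr_1 (V := C_NormedModule) (fun n => RtoC (INR (S n)) * a (S n))%C).
    set (g := fun z => (z * C_derive f z)%C).
    assert (Hg : forall z, in_disk z -> is_cpseries b z (g z)).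
    { intros z Hz. exact (is_pseries_incr_1 _ _ _ (proj2 (D z Hz))). }
    destruct (sector_coef_bound b g (cos (PI * s)) Hg) as [K [HK0 HK]].
    + reflexivity.
    + unfold b; simpl. rewrite ha1. ring.
    + exact Hc.
    + intros z Hz Hgz. exists (q_hpl s (w z)).
      split; [|apply q_hpl_sector; lra].
      assert (Hf' : C_derive f z <> 0).
      { intros E. apply Hgz. unfold g. rewrite E. ring. }
      rewrite <- (Hw z Hz). unfold convex_quotient.
      assert (Dg : C_derive g z = (1 * C_derive f z + z * C_derive (C_derive f) z)%C).
      { apply is_C_derive_unique. apply is_cderive_mult; [apply is_cderive_id|].
        apply (cpseries_derive _ (C_derive f) (fun z Hz => proj2 (D z Hz))), Hz. }
      rewrite Dg. unfold g. field. exact Hf'.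
    + exists K. split; [exact HK0|]. intros n Hn.
      assert (Hn' : 0 < INR n) by now apply lt_0_INR.
      specialize (HK n). destruct n as [|n]; [now apply Nat.nle_succ_0 in Hn|].
      change (b (S n)) with (INR (S n) * a (S n))%C in HK.
      rewrite Cmod_mult, Cmod_R, Rabs_pos_eq in HK by apply pos_INR.
      apply Rmult_le_reg_l with (INR (S n) ^ 2); [now apply pow_lt|].
      replace (INR (S n) ^ 2 * (K / INR (S n) ^ 2)) with K by (field; lra).
      lra.
Qed.
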